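(* Let $p,q,p',q'\in\mathbb N$ with $1\le p\le q-1$, $\gcd(p,q)=1$, $1\le p'\le q'-1$ and $\gcd(p',q')=1$. Then the $C^*$-algebra $\mathcal A_{p/q}$ is ($*$-)isomorphic to $\mathcal A_{p'/q'}$ if and only if $q'=q$ and either $p'=p$ or $p'=q-p$.
   Context: For $p,q\in\mathbb N$ with $1\le p\le q-1$ and $\gcd(p,q)=1$, the $C^*$-algebra $\mathcal A_{p/q}$ is defined as follows. Put $\omega=e^{2\pi i p/q}$. Let $\mathcal M_q$ be the algebra of complex $q\times q$ matrices and $e_1,\dots,e_q$ the standard basis of $\mathbb C^q$. Let $U_0,V_0\in\mathcal M_q$ be given by $U_0e_1=e_q$, $U_0e_j=e_{j-1}$ for $2\le j\le q$, and $V_0=\mathrm{diag}(1,\omega,\omega^2,\dots,\omega^{q-1})$. Let $H_q=L^2(\mathbb R^2,\mathbb C^q)$. Let $\mathcal P_q$ be the $C^*$-algebra of continuous $a:\mathbb R^2\to\mathcal M_q$ satisfying $a(x_1,x_2)=a(x_1+q,x_2)=a(x_1,x_2+q)$ for all $(x_1,x_2)\in\mathbb R^2$, regarded as a $C^*$-subalgebra of the bounded operators $\mathcal B(H_q)$ by $(av)(x)=a(x)v(x)$. Define $U,V\in\mathcal P_q$ by $U(x_1,x_2)=e^{2\pi i x_1/q}U_0$ and $V(x_1,x_2)=e^{2\pi i x_2/q}V_0$. Then $\mathcal A_{p/q}$ is the $C^*$-subalgebra of $\mathcal P_q$ generated by $\{U,V\}$ (the smallest norm-closed, adjoint-closed subalgebra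 containing $U$ and $V$). *)

(* Defs.v *)
From HB Require Import structures.
From mathcomp Require Import all_boot all_order all_algebra.
From mathcomp Require Import complex.
From mathcomp Require Import all_classical all_reals all_analysis.

Set Implicit Arguments.
Unset Strict Implicit.
Unset Printing Implicit Defensive.

Import Order.TTheory GRing.Theory Num.Theory.
Import numFieldNormedType.Exports.

Local Open Scope classical_set_scope.
Local Open Scope complex_scope.
Local Open Scope ring_scope.

(* The ascription makes the canonical topology of a numFieldType available on
   R[i], and hence on matrices over it. *)
Notation Cplx R := (R[i] : numClosedFieldType).

Notation matfun R q := (R * R -> 'M[Cplx R]_q).

Definition cis (R : realType) (t : R) : Cplx R := cos t +i* sin t.

(* The canonical basis e_1, ..., e_q is indexed by 0, ..., q-1, so this is the
   matrix sending e_1 to e_q and e_j to e_(j-1) for 2 <= j <= q. *)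
Definition U0 (R : realType) (q : nat) : 'M[Cplx R]_q :=
  \matrix_(i, j) (i.+1 == j %[mod q])%:R.

Definition V0 (R : realType) (p q : nat) : 'M[Cplx R]_q :=
  diag_mx (\row_(j < q) cis (2 * pi * p%:R / q%:R : R) ^+ j).

Definition Ufun (R : realType) (q : nat) : matfun R q :=
  fun x => cis (2 * pi * x.1 / q%:R) *: U0 R q.

Definition Vfun (R : realType) (p q : nat) : matfun R q :=
  fun x => cis (2 * pi * x.2 / q%:R) *: V0 R p q.

Section L2.
Variables (R : realType) (q : nat).

Let mu := (@lebesgue_measure R \x @lebesgue_measure R)%E.

(* Representatives of the classes in L^2(R^2, C^q). *)
Definition L2vec : set (R * R -> 'cV[Cplx R]_q) :=
  [set v | forall i : 'I_q,
     (fun x => complex.Re (v x i 0)) \in Lfun mu 2%:E /\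
     (fun x => complex.Im (v x i 0)) \in Lfun mu 2%:E].

Definition L2norm (v : R * R -> 'cV[Cplx R]_q) : \bar R :=
  Lnorm mu 2%:E (fun x => (Num.sqrt (\sum_(i < q)
    (complex.Re (v x i 0) ^+ 2 + complex.Im (v x i 0) ^+ 2)))%:E).

(* The norm of the multiplication operator v |-> (x |-> a x *m v x) on
   L^2(R^2, C^q). *)
Definition opnorm (a : matfun R q) : \bar R :=
  ereal_sup [set L2norm (fun x => a x *m v x) |
             v in [set v | L2vec v /\ (L2norm v <= 1)%E]].

End L2.

Definition mfmul (R : realType) (q : nat) (a b : matfun R q) : matfun R q :=
  fun x => a x *m b x.

Definition mfstar (R : realType) (q : nat) (a : matfun R q) : matfun R q :=
  fun x => (map_mx Num.conj (a x))^T.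

Definition periodic_alg (R : realType) (q : nat) : set (matfun R q) :=
  [set a | continuous a /\ forall x1 x2 : R,
     a (x1 + q%:R, x2) = a (x1, x2) /\ a (x1, x2 + q%:R) = a (x1, x2)].
Arguments periodic_alg : clear implicits.

Record Cstar_subalgebra (R : realType) (q : nat) (S : set (matfun R q)) : Prop :=
  CstarSubalgebra {
    Cstar_sub : S `<=` periodic_alg R q;
    Cstar_zero : S 0;
    Cstar_add : forall a b, S a -> S b -> S (a + b);
    Cstar_scale : forall (c : Cplx R) a, S a -> S (c *: a);
    Cstar_mul : forall a b, S a -> S b -> S (mfmul a b);
    Cstar_star : forall a, S a -> S (mfstar a);
    Cstar_closed : forall a, periodic_alg R q a ->
      (forall e : R, 0 < e -> exists2 b, S b & (opnorm (a - b)%R < e%:E)%E) -> S a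
  }.

Definition rotation_alg (R : realType) (p q : nat) : set (matfun R q) :=
  smallest (@Cstar_subalgebra R q) [set @Ufun R q; @Vfun R p q].
Arguments rotation_alg : clear implicits.

Definition Cstar_isomorphic (R : realType) (q q' : nat)
    (A : set (matfun R q)) (B : set (matfun R q')) : Prop :=
  exists phi : matfun R q -> matfun R q',
    [/\ set_bij A B phi,
        forall a b, A a -> A b -> phi (a + b) = phi a + phi b,
        forall (c : Cplx R) a, A a -> phi (c *: a) = c *: phi a,
        forall a b, A a -> A b -> phi (mfmul a b) = mfmul (phi a) (phi b) &
        forall a, A a -> phi (mfstar a) = mfstar (phi a)].

(* Main.v *)
(* Elements of the rotation algebra of p/q are matrix-valued functions on the
   plane which are periodic under unit translations up to conjugation by powers
   of the clock and shift matrices.  Let phi be an isomorphism onto the algebra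
   of p'/q'.  The values of u = phi U and v = phi V at a point satisfy
   u v = w v u with w a primitive q-th root of unity, so determinants give
   q | q', and q = q' by symmetry.  Such a pair is irreducible, so u^q and v^q
   are scalar, say exp(2 pi i F) and exp(2 pi i G), where F and G change by
   integers a, b and c, d under the two unit translations.  Characters of the
   centres show that (F, G) induces a homeomorphism of the torus, hence
   a d - b c = 1 or -1.  The normalised pair exp(-2 pi i F / q) u,
   exp(-2 pi i G / q) v has constant conjugacy class, and a continuous family T
   of matrices with positive determinant transports its value at the origin to
   its value at x.  Comparing T at the four corners of the unit square gives
   (a d - b c) / p = 1 / p' modulo q.  Conversely, the reflection x2 |-> - x2
   carries the algebra of p/q onto that of (q - p)/q. *)

Require Import Defs.
From mathcomp Require Import all_boot all_order all_algebra.
From mathcomp Require Import perm complex.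
From mathcomp Require Import all_classical all_reals all_analysis.
From mathcomp Require Import measurable_realfun ring lra zify.

Set Implicit Arguments.
Unset Strict Implicit.
Unset Printing Implicit Defensive.

Import Order.TTheory GRing.Theory Num.Theory.
Import numFieldNormedType.Exports.

Local Open Scope classical_set_scope.
Local Open Scope complex_scope.
Local Open Scope ring_scope.

(** * Continuity of complex and matrix-valued functions *)

(** An isomorphism [phi] is purely algebraic here, so nothing is transported through it by
    estimates: it only carries identities, and lifts, determinants and limits are handled inside
    each algebra. The L^2 norm enters only as uniform closeness of entries. No homeomorphism of tori
    is built either: the coordinate functions exp(2 pi i x1), exp(2 pi i x2) of the target come from
    central unitaries of the source, whose windings give an integer inverse of the winding matrix of
    (F, G).

    The obstacle is phase ambiguity. A matrix conjugating one irreducible pair into another is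
    unique only up to a scalar, which could hide the wanted root of unity. Positive determinants cut
    the phase down to a q-th root of unity, continuity makes it trivial, and the positive factor
    that remains disappears on taking moduli. The side holonomies then satisfy Y1 Y2 = zeta(-r') Y2
    Y1, inherited from the clock and shift matrices, and Y2 Y1 = zeta(r (a d - b c)) Y1 Y2, computed
    from the windings, where r and r' invert p and p' modulo q. *)

Section ContinuityToolkit.
Variable T : topologicalType.

Section NumField.
Variable K : numFieldType.
Implicit Types f g : T -> K.

Lemma continuous_addf f g : continuous f -> continuous g ->
  continuous (fun x => f x + g x).
Proof. by move=> cf cg x; apply: cvgD; [exact: cf|exact: cg]. Qed.

Lemma continuous_oppf f : continuous f -> continuous (fun x => - f x).
Proof. by move=> cf x; apply: cvgN; exact: cf. Qed.

Lemma continuous_mulf f g : continuous f -> continuous g ->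
  continuous (fun x => f x * g x).
Proof. by move=> cf cg x; apply: cvgM; [exact: cf|exact: cg]. Qed.

Lemma continuous_cstf (c : K) : continuous (fun _ : T => c).
Proof. by move=> x; exact: cvg_cst. Qed.

Lemma continuous_sumf (I : Type) (s : seq I) (P : pred I) (F : I -> T -> K) :
  (forall i, continuous (F i)) ->
  continuous (fun x => \sum_(i <- s | P i) F i x).
Proof.
move=> cF; elim: s => [|i s IHs].
  by under eq_fun do rewrite big_nil; exact: continuous_cstf.
under eq_fun do rewrite big_cons.
by case: (P i) => //; apply: continuous_addf.
Qed.

Lemma continuous_prodf (I : Type) (s : seq I) (P : pred I) (F : I -> T -> K) :
  (forall i, continuous (F i)) ->
  continuous (fun x => \prod_(i <- s | P i) F i x).
Proof.
move=> cF; elim: s => [|i s IHs].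
  by under eq_fun do rewrite big_nil; exact: continuous_cstf.
under eq_fun do rewrite big_cons.
by case: (P i) => //; apply: continuous_mulf.
Qed.

Lemma continuous_exprf n f : continuous f -> continuous (fun x => f x ^+ n).
Proof.
move=> cf; elim: n => [|n IHn].
  by under eq_fun do rewrite expr0; exact: continuous_cstf.
by under eq_fun do rewrite exprS; exact: continuous_mulf.
Qed.

Lemma continuous_mxP m n (a : T -> 'M[K]_(m, n)) :
  continuous a <-> forall i j, continuous (fun x => a x i j).
Proof.
split=> [ca i j x|ca x].
  apply: (@continuous_comp _ _ _ a (fun M : 'M[K]_(m, n) => M i j)).
    exact: ca.
  exact: coord_continuous.
move=> A [P nP sPA]; apply: (@filterS _ (nbhs x) _
  [set y | forall i j, P i j (a y i j)]) => [y Py|]; first exact: sPA.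
apply: filter_forall => i; apply: filter_forall => j.
by have := ca i j x (P i j) (nP i j).
Qed.

Lemma continuous_mulmx m n p (a : T -> 'M[K]_(m, n)) (b : T -> 'M[K]_(n, p)) :
  continuous a -> continuous b -> continuous (fun x => a x *m b x).
Proof.
move=> /continuous_mxP ca /continuous_mxP cb; apply/continuous_mxP => i j.
under eq_fun do rewrite mxE.
by apply: continuous_sumf => k; exact: continuous_mulf.
Qed.

Lemma continuous_addmx m n (a b : T -> 'M[K]_(m, n)) :
  continuous a -> continuous b -> continuous (fun x => a x + b x).
Proof.
move=> /continuous_mxP ca /continuous_mxP cb; apply/continuous_mxP => i j.
by under eq_fun do rewrite mxE; exact: continuous_addf.
Qed.

Lemma continuous_scalemx m n f (b : T -> 'M[K]_(m, n)) :
  continuous f -> continuous b -> continuous (fun x => f x *: b x).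
Proof.
move=> cf /continuous_mxP cb; apply/continuous_mxP => i j.
by under eq_fun do rewrite mxE; exact: continuous_mulf.
Qed.

Lemma continuous_cstmx m n (A : 'M[K]_(m, n)) : continuous (fun _ : T => A).
Proof. by move=> x; exact: cvg_cst. Qed.

Lemma continuous_summx m n (I : Type) (s : seq I) (F : I -> T -> 'M[K]_(m, n)) :
  (forall i, continuous (F i)) ->
  continuous (fun x => \sum_(i <- s) F i x).
Proof.
move=> cF; elim: s => [|i s IHs].
  by under eq_fun do rewrite big_nil; exact: continuous_cstmx.
by under eq_fun do rewrite big_cons; exact: continuous_addmx.
Qed.

Lemma continuous_expmx n (a : T -> 'M[K]_n) k :
  continuous a -> continuous (fun x => a x ^+ k).
Proof.
move=> ca; elim: k => [|k IHk].
  by under eq_fun do rewrite expr0; exact: continuous_cstmx.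
by under eq_fun do rewrite exprS; exact: continuous_mulmx.
Qed.

Lemma continuous_det n (a : T -> 'M[K]_n) :
  continuous a -> continuous (fun x => \det (a x)).
Proof.
move=> /continuous_mxP ca; rewrite /determinant.
apply: (@continuous_sumf _ _ _
  (fun (s : {perm 'I_n}) x => (-1) ^+ s * \prod_i a x i (s i))) => s.
apply: continuous_mulf.
  exact: continuous_cstf.
by apply: continuous_prodf => i.
Qed.

Lemma continuous_adj n (a : T -> 'M[K]_n) :
  continuous a -> continuous (fun x => \adj (a x)).
Proof.
move=> /continuous_mxP ca; apply/continuous_mxP => i j.
under eq_fun do rewrite mxE /cofactor.
apply: (@continuous_mulf (fun=> (-1) ^+ (j + i))
  (fun x => \det (row' j (col' i (a x))))); first exact: continuous_cstf.
apply: continuous_det; apply/continuous_mxP => k l.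
by under eq_fun do rewrite !mxE; exact: ca.
Qed.

Lemma continuous_scalar_mx n f : continuous f ->
  continuous (fun x => (f x)%:M : 'M[K]_n).
Proof.
move=> cf; apply/continuous_mxP => i j.
under eq_fun do rewrite mxE; case: (i == j); first exact: cf.
by under eq_fun do rewrite mulr0n; exact: continuous_cstf.
Qed.

End NumField.

End ContinuityToolkit.

Lemma continuous_id (T : topologicalType) : continuous (@id T).
Proof. by move=> x A. Qed.

Lemma continuous_compf (T U V : topologicalType) (f : T -> U) (g : U -> V) :
  continuous f -> continuous g -> continuous (fun x => g (f x)).
Proof.
by move=> cf cg x; apply: (@continuous_comp T U V f g); [exact: cf|exact: cg].
Qed.

Section ContinuityComplex.
Variables (T : topologicalType) (R : realType).

Lemma continuous_Re : continuous (@complex.Re R : Cplx R -> R).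
Proof.
move=> z; apply/(@cvgrPdist_lt R R _ (nbhs z) (nbhs_filter z)) => e e0.
have e0' : 0 < e%:C :> Cplx R by rewrite ltcR.
have := @cvgr_dist_lt (Cplx R) (Cplx R) _ (nbhs z) (nbhs_filter z) id z
  cvg_id _ e0'.
apply: filterS => w; rewrite -ltcR; apply: le_lt_trans.
by have := normc_ge_Re (z - w); rewrite raddfB.
Qed.

Lemma continuous_Im : continuous (@complex.Im R : Cplx R -> R).
Proof.
have -> : @complex.Im R = (fun z : Cplx R => - complex.Re (z * 'i%C)).
  by apply/funext => z; rewrite ReiNIm opprK.
have ci : continuous (fun z : Cplx R => (z * 'i%C : Cplx R)).
  apply: (@continuous_mulf (Cplx R) (Cplx R) id (fun=> 'i%C)).
    exact: continuous_id.
  exact: continuous_cstf.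
apply: (@continuous_oppf (Cplx R) R (fun z => complex.Re (z * 'i%C))) => z.
exact: (@continuous_comp (Cplx R) (Cplx R) R _ (@complex.Re R) z (ci z)
  (@continuous_Re _)).
Qed.

Lemma continuous_Ref (f : T -> Cplx R) :
  continuous f -> continuous (fun x => complex.Re (f x)).
Proof.
move=> cf x.
apply: (@continuous_comp T (Cplx R) R f (@complex.Re R)); first exact: cf.
exact: continuous_Re.
Qed.

Lemma continuous_Imf (f : T -> Cplx R) :
  continuous f -> continuous (fun x => complex.Im (f x)).
Proof.
move=> cf x.
apply: (@continuous_comp T (Cplx R) R f (@complex.Im R)); first exact: cf.
exact: continuous_Im.
Qed.

Lemma continuous_real_complex (f : T -> R) :
  continuous f -> continuous (fun x => (f x)%:C : Cplx R).
Proof.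
move=> cf x; apply/cvgrPdist_lt => -[e e'].
rewrite ltcE /= => /andP[/eqP -> e0].
have := @cvgr_dist_lt R R _ (nbhs x) (nbhs_filter x) f (f x) (cf x) e e0.
by apply: filterS => y; rewrite -raddfB normc_def /= expr0n addr0 sqrtr_sqr ltcR.
Qed.

Lemma continuous_complex (f g : T -> R) :
  continuous f -> continuous g -> continuous (fun x => f x +i* g x : Cplx R).
Proof.
move=> cf cg.
have -> : (fun x => f x +i* g x : Cplx R) = fun x => (f x)%:C + 'i%C * (g x)%:C.
  by apply/funext => x; rewrite [LHS]complexE.
apply: continuous_addf; first exact: continuous_real_complex.
by apply: continuous_mulf; [exact: continuous_cstf|exact: continuous_real_complex].
Qed.

Lemma continuous_conj (f : T -> Cplx R) :
  continuous f -> continuous (fun x => Num.conj (f x)).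
Proof.
move=> cf.
have -> : (fun x => Num.conj (f x)) =
    fun x => complex.Re (f x) +i* - complex.Im (f x) : Cplx R.
  by apply/funext => x; case: (f x).
apply: continuous_complex; first exact: continuous_Ref.
by apply: continuous_oppf; exact: continuous_Imf.
Qed.

End ContinuityComplex.

(** * The exponential t |-> exp(2 pi i t) *)

Section Exponential.
Variable R : realType.
Implicit Types s t : R.

Definition expi t : Cplx R := cis (2 * pi * t).

Lemma cisD s t : cis (s + t) = cis s * cis t.
Proof. by rewrite /cis cosD sinD; simpc; congr (_ +i* _); rewrite addrC. Qed.

Lemma expiD s t : expi (s + t) = expi s * expi t.
Proof. by rewrite /expi mulrDr cisD. Qed.

Lemma expi0 : expi 0 = 1.
Proof. by rewrite /expi mulr0 /cis cos0 sin0. Qed.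

Lemma expi_conj t : Num.conj (expi t) = expi (- t).
Proof. by rewrite /expi /cis mulrN cosN sinN. Qed.

Lemma expi_neq0 t : expi t != 0.
Proof.
by apply: contra_neq (oner_neq0 (Cplx R)); rewrite -expi0 -(subrr t) expiD => ->;
  rewrite mul0r.
Qed.

Lemma expiN t : expi (- t) = (expi t)^-1.
Proof.
by apply: (mulfI (expi_neq0 t)); rewrite -expiD subrr expi0 divff// expi_neq0.
Qed.

Lemma norm_expi t : `|expi t| = 1.
Proof. by rewrite normc_def /= cos2Dsin2 sqrtr1. Qed.

Lemma expiX t n : expi t ^+ n = expi (n%:R * t).
Proof.
elim: n => [|n IHn]; first by rewrite mul0r expi0.
by rewrite exprS IHn -expiD -[n.+1]add1n natrD mulrDl mul1r.
Qed.

Lemma expi_nat n : expi n%:R = 1.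
Proof.
rewrite -[n%:R]mulr1 -expiX.
by rewrite /expi mulr1 mulr_natl /cis cos2pi sin2pi expr1n.
Qed.

Lemma expi_int (n : int) : expi n%:~R = 1.
Proof. by case: n => n; rewrite ?NegzE ?mulrNz ?expiN expi_nat ?invr1. Qed.

(** With the floor removed, the cosine alone decides: [cos_inj] works on [0, pi], which covers a
    fractional part [r] up to 1/2, and a larger one is reflected to [1 - r]. *)
Lemma expi_eq1 t : expi t = 1 -> exists n : int, t = n%:~R.
Proof.
move=> e1; exists (Num.floor t).
set r := t - (Num.floor t)%:~R.
suff: r = 0 by move/eqP; rewrite subr_eq0 => /eqP.
have r1 : expi r = 1 by rewrite expiD e1 expiN expi_int invr1 mulr1.
have r0 : 0 <= r by rewrite subr_ge0 Num.Theory.floor_le_tmp.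
have rlt : r < 1 by rewrite ltrBlDl; have := Num.Theory.floorD1_gt t; rewrite intrD addrC.
have pi0 := pi_gt0 R.
have cr : cos (2 * pi * r) = 1 by case: r1.
have [rh|rh] := leP r (1/2).
  have := @cos_inj R (2 * pi * r) 0.
  rewrite cr cos0 !in_itv /= lexx pi_ge0 andbT => /(_ _ isT erefl) h.
  have /h/eqP : 0 <= 2 * pi * r <= pi by nra.
  by rewrite mulf_eq0 mulf_eq0 pnatr_eq0 (gt_eqF pi0) /= => /eqP.
have := @cos_inj R (2 * pi * (1 - r)) 0.
have -> : 2 * pi * (1 - r) = - (2 * pi * r) + pi *+ 2 by rewrite mulr2n; ring.
rewrite cosD2pi cosN cr cos0 !in_itv /= lexx pi_ge0 andbT.
move=> /(_ _ isT erefl).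
have -> : - (2 * pi * r) + pi *+ 2 = 2 * pi * (1 - r) by rewrite mulr2n; ring.
move=> h; have /h/eqP : 0 <= 2 * pi * (1 - r) <= pi by nra.
by rewrite mulf_eq0 mulf_eq0 pnatr_eq0 (gt_eqF pi0) /= subr_eq0 (gt_eqF rlt).
Qed.

Lemma expi_inj s t : expi s = expi t -> exists n : int, s = t + n%:~R.
Proof.
move=> e; have /expi_eq1[n sn] : expi (s - t) = 1.
  by rewrite expiD expiN e divff// expi_neq0.
by exists n; rewrite -sn addrC subrK.
Qed.

Lemma continuous_expi (T : topologicalType) (f : T -> R) :
  continuous f -> continuous (fun x => expi (f x)).
Proof.
move=> cf; rewrite /expi /cis.
have cm : continuous (fun x => 2 * pi * f x).
  by apply: continuous_mulf => //; exact: continuous_cstf.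
apply: continuous_complex => x.
  by apply: continuous_comp; [exact: cm|exact: continuous_cos].
by apply: continuous_comp; [exact: cm|exact: continuous_sin].
Qed.

(** The principal argument measured in turns; the arctangent formula gives it on the open right
    half-plane only. *)
Definition arg_near1 (z : Cplx R) : R :=
  atan (complex.Im z / complex.Re z) / (2 * pi).

Lemma expi_arg_near1 z : `|z| = 1 -> 0 < complex.Re z -> expi (arg_near1 z) = z.
Proof.
case: z => a b /= n1 a0.
have ab : a ^+ 2 + b ^+ 2 = 1.
  by have := add_Re2_Im2 (a +i* b); rewrite n1 expr1n => /(congr1 (@complex.Re R)).
rewrite /expi /arg_near1 /= mulrC divfK; last first.
  by rewrite mulf_neq0 ?pnatr_eq0// gt_eqF// pi_gt0.
have e1 : 1 + (b / a) ^+ 2 = (a ^-1) ^+ 2.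
  rewrite exprMn -[X in X + _](@mulfV _ (a ^+ 2)) ?expf_neq0 ?gt_eqF//.
  by rewrite exprVn -mulrDl ab mul1r.
have c : cos (atan (b / a)) = a.
  by rewrite cos_atan e1 sqrtr_sqr gtr0_norm ?invr_gt0// invrK.
have s : sin (atan (b / a)) = b.
  have := atanK (b / a); rewrite /tan c => /(congr1 ( *%R^~ a)).
  by rewrite !divfK ?gt_eqF.
by rewrite /cis c s.
Qed.

Lemma arg_near1_1 : arg_near1 1 = 0.
Proof. by rewrite /arg_near1 /= mul0r atan0 mul0r. Qed.

Lemma continuous_arg_near1 (T : topologicalType) (f : T -> Cplx R) :
  continuous f -> (forall x, 0 < complex.Re (f x)) ->
  continuous (fun x => arg_near1 (f x)).
Proof.
move=> cf f0; apply: continuous_mulf; last exact: continuous_cstf.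
apply: (continuous_compf _ (@continuous_atan R)) => x.
apply: cvgM; first exact: continuous_Imf.
by apply: cvgV; [rewrite gt_eqF|exact: continuous_Ref].
Qed.

Lemma expi_surj (z : Cplx R) : `|z| = 1 -> exists t, expi t = z.
Proof.
case: z => a b n1.
have ab : a ^+ 2 + b ^+ 2 = 1.
  by have := add_Re2_Im2 (a +i* b); rewrite n1 expr1n => /(congr1 (@complex.Re R)).
have a1 : -1 <= a <= 1 by nra.
have ca := acosK a1.
have sa : sin (acos a) = `|b|.
  by rewrite sin_acos// -sqrtr_sqr; congr Num.sqrt; rewrite -ab addrAC subrr add0r.
have pi2 : 2 * pi != 0 :> R by rewrite mulf_neq0 ?pnatr_eq0// gt_eqF// pi_gt0.
have [b0|b0] := leP 0 b.
  exists (acos a / (2 * pi)).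
  by rewrite /expi mulrCA divff// mulr1 /cis ca sa ger0_norm.
exists (- (acos a / (2 * pi))).
by rewrite /expi mulrN mulrCA divff// mulr1 /cis cosN sinN ca sa ltr0_norm ?opprK.
Qed.

Lemma expi_prim_root p q : (0 < q)%N -> coprime p q ->
  q.-primitive_root (expi (p%:R / q%:R)).
Proof.
move=> q0 pq; apply/andP; split => //; apply/forallP => i.
apply/eqP; rewrite unity_rootE expiX.
have qR : q%:R != 0 :> R by rewrite pnatr_eq0 -lt0n.
have [->|iq] := eqVneq i.+1 q.
  by rewrite mulrCA divff// mulr1 expi_nat eqxx.
apply/negbTE/eqP => /expi_eq1[n].
have /eqP : (i.+1%:R * (p%:R / q%:R) * q%:R : R) = (i.+1 * p)%:Z%:~R.
  by rewrite mulrA divfK// -natrM.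
move=> + e; rewrite e -[q%:R]/(q%:Z%:~R) -intrM eqr_int => /eqP h.
have : (q %| i.+1 * p)%N.
  have : (q%:Z %| (i.+1 * p)%:Z)%Z by rewrite -h; apply: dvdz_mull.
  by rewrite dvdzE.
rewrite Gauss_dvdl; last by rewrite coprime_sym.
move=> /dvdn_leq => /(_ isT); have := ltn_ord i.
by move: iq => /eqP; lia.
Qed.

End Exponential.

(** * Pairs of matrices commuting up to a root of unity *)

Section TwistedPairs.

(** Determinants forget the order of a product, so only w^n survives. On the whole space this yields
    divisibility of the sizes, on an eigenspace it yields irreducibility. *)
Lemma twisted_dim (F : fieldType) n (u v : 'M[F]_n) (w : F) :
  u \in unitmx -> v \in unitmx -> u *m v = w *: (v *m u) -> w ^+ n = 1.
Proof.
rewrite !unitmxE !unitfE => u0 v0 /(congr1 determinant).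
rewrite detZ !det_mulmx [\det v * _]mulrC -[LHS]mul1r => /esym.
by apply: mulIf; rewrite mulf_neq0.
Qed.

(* A common eigenspace of [B] is stable under [u] and [v], and comparing
   determinants on it shows that its dimension is a multiple of [q]. *)
Lemma twisted_commutant (C : numClosedFieldType) q (w : C) (u v B : 'M[C]_q) :
  q.-primitive_root w -> u \in unitmx -> v \in unitmx ->
  u *m v = w *: (v *m u) -> u *m B = B *m u -> v *m B = B *m v ->
  exists b, B = b%:M.
Proof.
move=> wq uu uv uvw cu cv; have q0 := prim_order_gt0 wq.
have [a /eigenvalueP[x xB x0]] := eigenvalue_closed B q0.
exists a; pose K := row_base (eigenspace B a).
have Kf : row_free K by exact: row_base_free.
have st (f : 'M[C]_q) : f *m B = B *m f -> stablemx K f.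
  move=> cf; rewrite stablemx_row_base.
  by apply: comm_mx_stable_eigenspace; rewrite /comm_mx cf.
have un (f : 'M[C]_q) : f \in unitmx -> f *m B = B *m f ->
    conjmx K f \in unitmx.
  move=> uf cf.
  have cf' : invmx f *m B = B *m invmx f.
    by rewrite -[LHS](mulmxK uf) -[_ *m B *m _]mulmxA -cf mulKmx.
  have : conjmx K f *m conjmx K (invmx f) = 1%:M.
    by rewrite -conjmxM ?inE ?st// mulmxV// /conjmx mulmx1 mulmxVp.
  by case/mulmx1_unit.
have /twisted_dim : conjmx K u *m conjmx K v = w *: (conjmx K v *m conjmx K u).
  by rewrite -!conjmxM ?inE ?st// uvw /conjmx -scalemxAr -scalemxAl.
move=> /(_ (un _ uu cu) (un _ uv cv)) /eqP.
rewrite -(prim_order_dvd wq) => /dvdn_leq.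
have : (0 < \rank (eigenspace B a))%N.
  rewrite lt0n mxrank_eq0; apply/eqP => E0.
  have /eigenspaceP : x *m B = a *: x by [].
  by rewrite E0 submx0 (negbTE x0).
move=> /[swap] /[apply] qK.
have : row_full (eigenspace B a) by rewrite /row_full eqn_leq rank_leq_col.
rewrite -sub1mx => /eigenspaceP.
by rewrite mul1mx scalemx1.
Qed.

(** Preparation for Schur's lemma: two solutions of the same twisted relation differ by a factor
    commuting with [a], which [twisted_commutant] then turns into a scalar. *)
Lemma twisted_ratio_comm (F : fieldType) q (c : F) (a X Y : 'M[F]_q) :
  X \in unitmx -> X *m a = c *: (a *m X) -> Y *m a = c *: (a *m Y) ->
  a *m (invmx X *m Y) = invmx X *m Y *m a.
Proof.
move=> uX eX eY; apply: (can_inj (mulKmx uX)).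
rewrite !mulmxA mulmxV// mul1mx eY eX -!scalemxAl; congr (_ *: _).
by rewrite -!mulmxA mulKVmx.
Qed.

Lemma root1_unitmx (F : fieldType) q (A : 'M[F]_q) :
  (0 < q)%N -> A ^+ q = 1 -> A \in unitmx.
Proof.
case: q A => // n A _; rewrite exprS => A1.
by have [] := mulmx1_unit A1.
Qed.

(** Averaging over the cyclic group of order [q]: the sum of u'^j X u^(-j), with u^(q - j) for
    u^(-j) so that no inverse appears. *)
Definition twisted_avg (F : fieldType) q (u' u X : 'M[F]_q) : 'M[F]_q :=
  \sum_(j < q) u' ^+ j * X * u ^+ (q - j).

Lemma twisted_avgP (F : fieldType) q (u' u X : 'M[F]_q) :
  u ^+ q = 1 -> u' ^+ q = 1 -> u' * twisted_avg u' u X = twisted_avg u' u X * u.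
Proof.
move=> u1 u'1; rewrite /twisted_avg mulr_sumr mulr_suml.
case: q u' u X u1 u'1 => [|q] u' u X u1 u'1; first by rewrite !big_ord0.
(* Left multiplication shifts the index by one; the last term on the left wraps around to the first
   on the right because both powers of full order are 1. *)
rewrite big_ord_recr [RHS]big_ord_recl /= addrC; congr (_ + _).
  by rewrite subSnn expr1 !mulrA -exprS u'1 mul1r subn0 u1 mulr1.
apply: eq_bigr => i _; rewrite /bump /= add1n !mulrA -exprS -!mulrA -exprSr.
by rewrite subSS -subSn// ltnW.
Qed.

Lemma exp_twist (F : fieldType) q (w : F) (u v : 'M[F]_q) k :
  u * v = w *: (v * u) -> u ^+ k * v = w ^+ k *: (v * u ^+ k).
Proof.
move=> uv; elim: k => [|k IHk]; first by rewrite !expr0 scale1r mul1r mulr1.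
rewrite exprS -mulrA IHk -[u * _]/(u *m _) -scalemxAr.
rewrite -[_ *m _]/(u * (v * u ^+ k)) mulrA uv -[_ * u ^+ k]/(_ *m _) -scalemxAl.
by rewrite scalerA -exprSr; congr (_ *: _); exact: (esym (mulmxA _ _ _)).
Qed.

(** Passing v' across u'^j and v across u^(q - j) costs the phases w^j and w^(q - j), whose product
    w^q is 1. *)
Lemma twisted_avg_comm (F : fieldType) q (w : F) (u' v' u v X : 'M[F]_q) :
  w ^+ q = 1 -> u * v = w *: (v * u) -> u' * v' = w *: (v' * u') ->
  v' * X = X * v -> v' * twisted_avg u' u X = twisted_avg u' u X * v.
Proof.
move=> w1 uv uv' vX; rewrite /twisted_avg mulr_sumr mulr_suml.
apply: eq_bigr => j _.
have w0 : w != 0.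
  have q0 : (0 < q)%N by apply: leq_ltn_trans (ltn_ord j).
  by apply: contra_eq_neq w1 => ->; rewrite expr0n gtn_eqF// eq_sym oner_neq0.
apply: (@scalerI _ _ (w ^+ j)); first by rewrite expf_neq0.
have eA := exp_twist j uv'; have eB := exp_twist (q - j) uv.
move: (u' ^+ j) (u ^+ (q - j)) eA eB => A B.
rewrite -[A * v']/(A *m v') -[v' * A]/(v' *m A) -[B * v]/(B *m v).
rewrite -[v * B]/(v *m B) -[v' * (A * X * B)]/(v' *m (A *m X *m B)).
rewrite -[A * X * B * v]/(A *m X *m B *m v) => eA eB.
have vX' : v' *m X = X *m v := vX.
rewrite -[in RHS](mulmxA _ B) eB -scalemxAr scalerA -exprD subnKC; last exact/ltnW.
by rewrite w1 scale1r !mulmxA -(mulmxA _ X v) -vX' !mulmxA eA -!scalemxAl.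
Qed.

(** The identity averaged over [v], then over [u]. It is polynomial in the four matrices, hence
    continuous, but may be singular; for two equal pairs it is q^2 ([intertwiner_diag]), so nearby
    pairs give an invertible matrix. *)
Definition intertwiner (F : fieldType) q (u' v' u v : 'M[F]_q) : 'M[F]_q :=
  twisted_avg u' u (twisted_avg v' v 1).

Lemma intertwinerP (F : fieldType) q (w : F) (u' v' u v : 'M[F]_q) :
  w ^+ q = 1 -> u * v = w *: (v * u) -> u' * v' = w *: (v' * u') ->
  u ^+ q = 1 -> v ^+ q = 1 -> u' ^+ q = 1 -> v' ^+ q = 1 ->
  u' * intertwiner u' v' u v = intertwiner u' v' u v * u /\
  v' * intertwiner u' v' u v = intertwiner u' v' u v * v.
Proof.
move=> w1 uv uv' u1 v1 u'1 v'1; split; first exact: twisted_avgP.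
by apply: (twisted_avg_comm w1 uv uv'); exact: twisted_avgP.
Qed.

Lemma twisted_avg_diag (F : fieldType) q (u : 'M[F]_q) (c : F) :
  u ^+ q = 1 -> twisted_avg u u c%:M = (q%:R * c)%:M.
Proof.
move=> u1; rewrite /twisted_avg (eq_bigr (fun=> c%:M)).
  by rewrite sumr_const card_ord mulr_natl raddfMn.
move=> j _; rewrite -[_ * c%:M]/(_ *m _) -[c%:M]scalemx1 -scalemxAr mulmx1.
rewrite -[_ * _]/(_ *m _) -scalemxAl -[_ *m _]/(_ * _) -exprD subnKC ?u1//.
exact/ltnW.
Qed.

Lemma intertwiner_diag (F : fieldType) q (u v : 'M[F]_q) :
  u ^+ q = 1 -> v ^+ q = 1 -> intertwiner u v u v = (q%:R * q%:R)%:M.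
Proof.
move=> u1 v1; rewrite /intertwiner -[1]/(1%:M) twisted_avg_diag// mulr1.
by rewrite twisted_avg_diag.
Qed.

End TwistedPairs.

(** * The operator norm and the size of the entries *)

Section OperatorNorm.
Variable R : realType.
Variable q : nat.
Let mu := (@lebesgue_measure R \x @lebesgue_measure R)%E.
(* Lebesgue measure is defined on this copy of the measurable space [R]. *)
Let plane : measurableType _ :=
  (g_sigma_algebraType (R.-ocitv.-measurable) *
   g_sigma_algebraType (R.-ocitv.-measurable))%type.
Implicit Types (a : matfun R q) (v : R * R -> 'cV[Cplx R]_q).

Definition sqnorm (w : 'cV[Cplx R]_q) : R :=
  \sum_(i < q) (complex.Re (w i 0) ^+ 2 + complex.Im (w i 0) ^+ 2).

Lemma sqnorm_ge0 w : 0 <= sqnorm w.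
Proof. by apply: sumr_ge0 => i _; rewrite addr_ge0 ?sqr_ge0. Qed.

Lemma sqnormE w : (sqnorm w)%:C = \sum_(i < q) `|w i 0| ^+ 2.
Proof. by rewrite /sqnorm rmorph_sum; apply: eq_bigr => i _; exact: add_Re2_Im2. Qed.

Lemma L2normE v : L2norm v = ((\int[mu]_x (sqnorm (v x))%:E) `^ 2^-1)%E.
Proof.
rewrite /L2norm unlock /=; congr (_ `^ _)%E.
apply: eq_integral => x _.
rewrite ger0_norm ?sqrtr_ge0// powR_mulrn ?sqrtr_ge0//.
by rewrite sqr_sqrtr// sqnorm_ge0.
Qed.

(** The nonnegative integral is a supremum over simple functions below the integrand, so
    monotonicity holds for arbitrary functions; this covers [sqnorm (a x *m v x)] with [a] merely
    bounded. *)
Lemma ge0_integral_mono (f g : R * R -> \bar R) :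
  (forall x, (0 <= f x)%E) -> (forall x, (f x <= g x)%E) ->
  (\int[mu]_x f x <= \int[mu]_x g x)%E.
Proof.
move=> f0 fg; rewrite !ge0_integralTE//; last first.
  by move=> x; exact: le_trans (fg x).
apply: le_ereal_sup => _ [h hf <-]; exists h => // x.
exact: le_trans (hf x) (fg x).
Qed.

Lemma poweR_half_mono (x y : \bar R) :
  (0 <= x)%E -> (x <= y)%E -> (x `^ 2^-1 <= y `^ 2^-1)%E.
Proof.
move=> x0 xy; apply: gt0_ler_poweR => //; rewrite ?invr_ge0//.
  by rewrite in_itv /= x0 leey.
by rewrite in_itv /= (le_trans x0 xy) leey.
Qed.

Lemma poweR_half_sqr (k : R) : 0 <= k -> ((k ^+ 2)%:E `^ 2^-1 = k%:E)%E.
Proof.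
by move=> k0; rewrite poweR_EFin powR12_sqrt ?sqr_ge0// sqrtr_sqr ger0_norm.
Qed.

(** Every entry of [A *m w] is at most q e |w|; summing q squares gives the factor q^3 e^2, rounded
    up to the perfect square q^4 e^2. *)
Lemma sqnorm_mulmx (A : 'M[Cplx R]_q) (e : R) w : 0 <= e ->
  (forall i j, `|A i j| <= e%:C) ->
  sqnorm (A *m w) <= (q%:R ^+ 2 * e) ^+ 2 * sqnorm w.
Proof.
move=> e0 Ae.
have wi i : `|w i 0| <= (Num.sqrt (sqnorm w))%:C :> Cplx R.
  have -> : `|w i 0| = (Num.sqrt (complex.Re (w i 0) ^+ 2 + complex.Im (w i 0) ^+ 2))%:C.
    exact: normc_def.
  rewrite lecR ler_sqrt ?sqnorm_ge0// /sqnorm (bigD1 i)//= lerDl.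
  by apply: sumr_ge0 => k _; rewrite addr_ge0 ?sqr_ge0.
have Awi i : `|(A *m w) i 0| <= (q%:R * (e * Num.sqrt (sqnorm w)))%:C :> Cplx R.
  rewrite mxE (le_trans (ler_norm_sum _ _ _))//.
  rewrite rmorphM /= rmorph_nat -[q in q%:R]card_ord mulr_natl -sumr_const.
  by apply: ler_sum => j _; rewrite normrM rmorphM ler_pM.
rewrite -lecR sqnormE.
apply: (@le_trans _ _ (\sum_(i < q) (q%:R * (e * Num.sqrt (sqnorm w)))%:C ^+ 2)).
  by apply: ler_sum => i _; rewrite lerXn2r ?nnegrE// lecR !mulr_ge0 ?sqrtr_ge0.
rewrite sumr_const card_ord -rmorphXn -rmorphMn lecR -mulr_natl.
rewrite !exprMn sqr_sqrtr ?sqnorm_ge0// !mulrA ler_wpM2r ?sqnorm_ge0//.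
rewrite ler_wpM2r// 3?ler_wpM2r// -natrX ler_nat.
by case: (q) => // n; exact: leq_pmulr.
Qed.

Lemma L2vec_measurable v : L2vec v ->
  measurable_fun [set: plane] (fun x : plane => sqnorm (v x)).
Proof.
move=> Lv; apply: measurable_sum => i.
have [/andP[/set_mem mre _] /andP[/set_mem mim _]] := Lv i.
by apply: measurable_funD; [exact: (measurable_funX 2 mre)|exact: (measurable_funX 2 mim)].
Qed.

(** With [opnorm_ge], this identifies closeness in operator norm with uniform closeness of the
    entries, the form in which norm closure is used afterwards. *)
Lemma opnorm_le a (e : R) : 0 <= e -> (forall x i j, `|a x i j| <= e%:C) ->
  (opnorm a <= (q%:R ^+ 2 * e)%:E)%E.
Proof.
move=> e0 ae; apply: ge_ereal_sup => _ [v [Lv v1] <-].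
have k0 : 0 <= q%:R ^+ 2 * e by rewrite mulr_ge0.
rewrite L2normE.
apply: (@le_trans _ _
  ((\int[mu]_x (((q%:R ^+ 2 * e) ^+ 2)%:E * (sqnorm (v x))%:E)) `^ 2^-1)%E).
  apply: poweR_half_mono; first by apply: integral_ge0 => x _; rewrite lee_fin sqnorm_ge0.
  apply: ge0_integral_mono => x; rewrite ?lee_fin ?sqnorm_ge0//.
  exact: sqnorm_mulmx.
rewrite ge0_integralZl//; [|apply/measurable_EFinP; exact (L2vec_measurable Lv)|
  by move=> x _; rewrite lee_fin sqnorm_ge0|by rewrite lee_fin sqr_ge0].
rewrite poweRM ?lee_fin ?sqr_ge0//; last first.
  by apply: integral_ge0 => x _; rewrite lee_fin sqnorm_ge0.
rewrite -L2normE poweR_half_sqr// -[leRHS]mule1.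
by apply: lee_wpmul2l; rewrite ?lee_fin.
Qed.

Lemma nbhs_box (x : R * R) (A : set (R * R)) : nbhs x A ->
  exists2 d : R, 0 < d &
    `]x.1 - d, x.1 + d[ `*` `]x.2 - d, x.2 + d[ `<=` A.
Proof.
move=> /nbhs_ballP[d d0 dA]; exists d => // y [/= y1 y2]; apply: dA; split.
  by rewrite /ball/= ltr_distlC; move: y1; rewrite in_itv.
by rewrite /ball/= ltr_distlC; move: y2; rewrite in_itv.
Qed.

Lemma box_measure (x : R * R) (d : R) : 0 < d ->
  mu (`]x.1 - d, x.1 + d[ `*` `]x.2 - d, x.2 + d[) = ((2 * d) ^+ 2)%:E.
Proof.
move=> d0.
have h (c : R) : lebesgue_measure (`]c - d, c + d[%classic : set R) = (2 * d)%:E.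
  rewrite lebesgue_measure_itv /= lte_fin ifT; last by lra.
  by rewrite -EFinB; congr (_%:E); ring.
rewrite /mu product_measure1E//; try exact: measurable_itv.
rewrite expr2 EFinM; congr (_ * _)%E; exact: h.
Qed.

Definition bump_vec (B : set plane) (c : R) (j : 'I_q) : R * R -> 'cV[Cplx R]_q :=
  fun x => (c * \1_B x)%:C *: delta_mx j 0.

Lemma bump_vecE B c j x i :
  bump_vec B c j x i 0 = (if i == j then c * \1_B x else 0)%:C.
Proof. by rewrite !mxE eqxx andbT; case: eqP => _; rewrite ?mulr1 ?mulr0. Qed.

Lemma sqr_indic (B : set plane) x : (\1_B x : R) ^+ 2 = \1_B x.
Proof. by rewrite indicE; case: (_ \in _); rewrite ?expr1n// expr0n. Qed.

Lemma sqnorm_bump B c j x : sqnorm (bump_vec B c j x) = c ^+ 2 * \1_B x.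
Proof.
rewrite /sqnorm (bigD1 j)//= bump_vecE eqxx /= expr0n addr0 exprMn sqr_indic.
rewrite big1 ?addr0// => i /negbTE ij.
by rewrite bump_vecE ij /= expr0n addr0.
Qed.

Lemma integral_sqr_indic (B : set plane) (c : R) : measurable B ->
  (\int[mu]_x (c ^+ 2 * \1_B x)%:E = (c ^+ 2)%:E * mu B)%E.
Proof.
move=> mB; under eq_integral do rewrite EFinM.
rewrite ge0_integralZl ?lee_fin ?sqr_ge0// ?integral_indic ?setIT//.
by apply/measurable_EFinP; exact: measurable_indic.
Qed.

Lemma L2vec_bump (B : set plane) c j :
  measurable B -> (mu B < +oo)%E -> L2vec (bump_vec B c j).
Proof.
move=> mB fB i.
have Lf (k : R) : (fun x => k * \1_B x) \in Lfun mu 2%:E.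
  apply/andP; split; rewrite inE /=.
    by apply: measurable_funM => //; exact: measurable_indic.
  rewrite /finite_norm unlock /=; apply: poweR_lty.
  rewrite (_ : (fun x => _) = fun x => (k ^+ 2 * \1_B x)%:E); last first.
    apply/funext => x; rewrite powR_mulrn ?normr_ge0//.
    by rewrite real_normK ?num_real// exprMn sqr_indic.
  by rewrite integral_sqr_indic// lte_mul_pinfty// lee_fin sqr_ge0.
split.
- rewrite (_ : (fun x => _) = fun x => (if i == j then c else 0) * \1_B x).
    exact: Lf.
  by apply/funext => x; rewrite bump_vecE; case: eqP => //=; rewrite mul0r.
- rewrite (_ : (fun x => _) = fun x => 0 * \1_B x); first exact: Lf.
  by apply/funext => x; rewrite bump_vecE mul0r.
Qed.

Lemma mul_bump a B c i j x :
  (`|a x i j| ^+ 2 : Cplx R) * (c ^+ 2 * \1_B x)%:C <=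
  (sqnorm (a x *m bump_vec B c j x))%:C.
Proof.
rewrite sqnormE (bigD1 i)//= -[X in X <= _]addr0 lerD//; last first.
  by apply: sumr_ge0 => k _; rewrite exprn_ge0.
rewrite mxE (bigD1 j)//= big1 ?addr0; last first.
  by move=> k /negbTE kj; rewrite bump_vecE kj mulr0.
rewrite bump_vecE eqxx normrM exprMn ler_wpM2l ?exprn_ge0//.
by rewrite -add_Re2_Im2 /= expr0n addr0 exprMn sqr_indic.
Qed.

(** The square has area (2 d)^2, so the height 1 / (2 d) gives norm one. *)
Lemma bump_unit (x : R * R) (d : R) (j : 'I_q) (B : set plane) (c : R) :
  0 < d -> B = `]x.1 - d, x.1 + d[ `*` `]x.2 - d, x.2 + d[ -> c = (2 * d)^-1 ->
  L2vec (bump_vec B c j) /\ (\int[mu]_y (sqnorm (bump_vec B c j y))%:E = 1)%E.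
Proof.
move=> d0 BE cE.
have mB : measurable B by rewrite BE; apply: measurableX; exact: measurable_itv.
have muB : mu B = ((2 * d) ^+ 2)%:E by rewrite BE; exact: box_measure.
split; first by apply: L2vec_bump => //; rewrite muB ltry.
under eq_integral do rewrite sqnorm_bump.
by rewrite integral_sqr_indic// muB cE -EFinM -exprMn mulVf ?expr1n// mulf_neq0 ?gt_eqF.
Qed.

(** If an entry exceeded [e] at a point, by continuity it would do so on a small square; the
    normalised bump there in direction [j] would have an image of norm at least [e], against
    [opnorm a < e]. *)
Lemma opnorm_ge a (e : R) : continuous a -> (opnorm a < e%:E)%E ->
  forall x i j, `|a x i j| <= e%:C.
Proof.
move=> ca ae x i j.
have le_opnorm v : L2vec v -> (\int[mu]_y (sqnorm (v y))%:E = 1)%E ->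
    (L2norm (fun y => a y *m v y) <= opnorm a)%E.
  move=> Lv iv; apply: ereal_sup_ubound; exists v => //.
  by split => //; rewrite L2normE iv poweR1r.
(* The sign of [e] comes from the existence of a unit vector: the norm of its image is nonnegative
   and at most [opnorm a]. *)
have e0 : 0 <= e.
  have [Lv iv] := @bump_unit x 1 j _ _ ltr01 erefl erefl.
  rewrite -lee_fin; apply: le_trans (ltW ae); apply: le_trans (le_opnorm _ Lv iv).
  exact: Lnorm_ge0.
have -> : `|a x i j| = (Num.sqrt (complex.Re (a x i j) ^+ 2 + complex.Im (a x i j) ^+ 2))%:C.
  exact: normc_def.
rewrite lecR leNgt; apply/negP => lt_ea.
pose f y := Num.sqrt (complex.Re (a y i j) ^+ 2 + complex.Im (a y i j) ^+ 2).
have /continuous_mxP/(_ i j) ce := ca.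
have cf : continuous f.
  apply: (continuous_compf _ (@sqrt_continuous R)).
  apply: continuous_addf; apply: continuous_exprf.
    exact: continuous_Ref.
  exact: continuous_Imf.
have /nbhs_box[d d0 dB] : nbhs x [set y | e < f y].
  exact: (cf x) (lt_nbhsr lt_ea).
set B : set plane := _ `*` _ in dB.
pose c := (2 * d)^-1.
have [] := @bump_unit x d j B c d0 erefl erefl.
set v := bump_vec B c j => Lv iv.
have : (e%:E <= opnorm a)%E.
  apply: le_trans (le_opnorm _ Lv iv).
  rewrite L2normE.
  rewrite -poweR_half_sqr// -[X in (X `^ _ <= _)%E]mule1 -iv.
  rewrite -ge0_integralZl//; [|apply/measurable_EFinP; exact (L2vec_measurable Lv)|
    by move=> y _; rewrite lee_fin sqnorm_ge0|by rewrite lee_fin sqr_ge0].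
  apply: poweR_half_mono.
    by apply: integral_ge0 => y _; rewrite mule_ge0 ?lee_fin ?sqr_ge0 ?sqnorm_ge0.
  apply: ge0_integral_mono => y.
    by rewrite mule_ge0 ?lee_fin ?sqr_ge0 ?sqnorm_ge0.
  rewrite -EFinM lee_fin -lecR; apply: le_trans (mul_bump a B c i j y).
  rewrite sqnorm_bump.
  have [yB|yB] := boolP (y \in B); last first.
    by rewrite indicE (negbTE yB) !mulr0.
  rewrite rmorphM ler_wpM2r//; first by rewrite ler0c mulr_ge0 ?sqr_ge0.
  rewrite -add_Re2_Im2 lecR -[leRHS]sqr_sqrtr ?addr_ge0 ?sqr_ge0//.
  by rewrite lerXn2r ?nnegrE ?sqrtr_ge0// ltW//; apply: dB; exact: set_mem.
by rewrite leNgt ae.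
Qed.

End OperatorNorm.

(** * Lifting of unimodular functions to the line *)

Section Lifting.
Variable R : realType.

Lemma continuous_pairf (T U V : topologicalType) (f : T -> U) (g : T -> V) :
  continuous f -> continuous g -> continuous (fun x => (f x, g x)).
Proof. by move=> cf cg x; apply: cvg_pair; [exact: cf|exact: cg]. Qed.

Lemma continuous_fst (U V : topologicalType) : continuous (@fst U V).
Proof. by move=> x; exact: cvg_fst. Qed.

Lemma continuous_snd (U V : topologicalType) : continuous (@snd U V).
Proof. by move=> x; exact: cvg_snd. Qed.

Lemma continuous_fstf (T U V : topologicalType) (f : T -> U * V) :
  continuous f -> continuous (fun x => (f x).1).
Proof. by move=> cf; apply: (continuous_compf cf); exact: continuous_fst. Qed.

Lemma continuous_sndf (T U V : topologicalType) (f : T -> U * V) :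
  continuous f -> continuous (fun x => (f x).2).
Proof. by move=> cf; apply: (continuous_compf cf); exact: continuous_snd. Qed.

(** Retracting the plane onto a box lets compactness of the box be used with functions that are
    continuous on the whole plane. *)
Definition clamp1 (r t : R) := Num.max (- r) (Num.min r t).
Definition clamp r (x : R * R) := (clamp1 r x.1, clamp1 r x.2).
Definition dilate (t : R) (x : R * R) := (t * x.1, t * x.2).
Definition in_box r (x : R * R) := - r <= x.1 <= r /\ - r <= x.2 <= r.

Lemma clamp_in_box r x : 0 <= r -> in_box r (clamp r x).
Proof.
have Nr : 0 <= r -> - r <= r by lra.
by move=> r0; split => /=; rewrite /clamp1 le_max lexx ge_max ge_min lexx /= Nr.
Qed.

Lemma clamp_id r x : in_box r x -> clamp r x = x.
Proof.
case: x => x1 x2 [/= /andP[x1a x1b] /andP[x2a x2b]].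
by rewrite /clamp /clamp1 /=; congr (_, _); rewrite min_r// max_r.
Qed.

Lemma in_box_dilate r t x : 0 <= t <= 1 -> in_box r x -> in_box r (dilate t x).
Proof. by rewrite /in_box /= => t01 [x1 x2]; split; nra. Qed.

Lemma continuous_clamp r : continuous (clamp r).
Proof.
have c1 : continuous (clamp1 r).
  apply: (@max_fun_continuous _ _ R (fun=> - r) (fun t => Num.min r t)).
    exact: continuous_cstf.
  apply: (@min_fun_continuous _ _ R (fun=> r) id); first exact: continuous_cstf.
  exact: continuous_id.
by apply: continuous_pairf; apply: continuous_compf c1;
  [exact: continuous_fst|exact: continuous_snd].
Qed.

Lemma continuous_dilate (T : topologicalType) (t : T -> R) (x : T -> R * R) :
  continuous t -> continuous x -> continuous (fun y => dilate (t y) (x y)).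
Proof.
move=> ct cx; apply: continuous_pairf; apply: continuous_mulf => //.
  exact: continuous_fstf.
exact: continuous_sndf.
Qed.

(* Minimise [|s - t|] over the compact set of the [(x, s, t)] for which
   [D (s x, t x)] is not positive. *)
Lemma diagonal_subdivision (r : R) (D : (R * R) * (R * R) -> R) : 0 <= r ->
  continuous D -> (forall x, 0 < D (x, x)) ->
  exists2 N : nat, (0 < N)%N & forall x (k : nat), (k < N)%N ->
    0 < D (dilate (k.+1%:R / N%:R) (clamp r x), dilate (k%:R / N%:R) (clamp r x)).
Proof.
move=> r0 cD D0.
pose g (z : (R * R) * (R * R)) := D (dilate z.2.1 z.1, dilate z.2.2 z.1).
have cg : continuous g.
  apply: continuous_compf cD; apply: continuous_pairf; apply: continuous_dilate.
  - by apply: continuous_fstf; exact: continuous_snd.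
  - exact: continuous_fst.
  - by apply: continuous_sndf; exact: continuous_snd.
  - exact: continuous_fst.
pose K := (`[- r, r] `*` `[- r, r]) `*` (`[0, 1] `*` `[0, 1]) : set ((R * R) * (R * R)).
have cK : compact K by do !apply: compact_setX; exact: segment_compact.
pose K0 := K `&` g @^-1` [set y | y <= 0].
have cK0 : compact K0.
  apply: compact_closedI => //; apply: preimage_closed; last exact: closed_le.
  by move=> z _; exact: cg.
pose d (z : (R * R) * (R * R)) := `|z.2.1 - z.2.2|.
have cd : continuous d.
  apply: (@continuous_compf _ R R (fun z : (R * R) * (R * R) => z.2.1 - z.2.2)).
    apply: continuous_addf.
      by apply: continuous_fstf; exact: continuous_snd.
    by apply: continuous_oppf; apply: continuous_sndf; exact: continuous_snd.
  exact: norm_continuous.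
have [eta eta0 deta] : exists2 eta, 0 < eta & forall z, K0 z -> eta <= d z.
  have [K00|/set0P K0n] := eqVneq K0 set0.
    by exists 1 => // z; rewrite K00.
  have [c /set_mem[Kc gc] dc] := compact_EVT_min K0n cK0 (continuous_subspaceT cd).
  exists (d c) => [|z K0z]; last by apply: dc; exact: mem_set.
  rewrite normr_gt0 subr_eq0; apply: contraPN gc => /eqP e.
  by apply/negP; rewrite -ltNge /g e.
(* This makes 1/N smaller than [eta], so consecutive parameters k/N are too close to give a point of
   [K0]. *)
pose N := (Num.truncn eta^-1).+1.
have N0 : 0 < N%:R :> R by rewrite ltr0n.
exists N => // x k kN.
rewrite ltNge; apply/negP => Dle.
have /deta : K0 (clamp r x, (k.+1%:R / N%:R, k%:R / N%:R)).
  split => //; split => /=.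
    by have [] := clamp_in_box x r0; rewrite /= !in_itv.
  rewrite !in_itv /=; split.
    by rewrite divr_ge0// ler_pdivrMr// mul1r ler_nat.
  by rewrite divr_ge0// ler_pdivrMr// mul1r ler_nat ltnW.
rewrite /d /= -mulrBl -natrB// subSnn mul1r gtr0_norm ?invr_gt0//.
rewrite leNgt => /negP; apply; rewrite invf_plt ?posrE//.
exact: truncnS_gt.
Qed.

(** The quotient f(x) / f(0) telescopes into ratios at consecutive points of the segment from the
    origin. For a fine subdivision these lie in the right half-plane, where [arg_near1] is a
    continuous logarithm; conjugation serves as inverse since |f| = 1. *)
Lemma box_lift (f : R * R -> Cplx R) (r th : R) : 0 <= r ->
  continuous f -> (forall x, `|f x| = 1) -> expi th = f (0, 0) ->
  exists F : R * R -> R, [/\ continuous F, F (0, 0) = th &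
    forall x, in_box r x -> expi (F x) = f x].
Proof.
move=> r0 cf f1 th0.
pose h (z : (R * R) * (R * R)) := f z.1 * Num.conj (f z.2).
have ch : continuous h.
  apply: continuous_mulf; first by apply: continuous_compf cf; exact: continuous_fst.
  by apply: continuous_conj; apply: continuous_compf cf; exact: continuous_snd.
have h1 x : h (x, x) = 1 by rewrite /h /= -normCK f1 expr1n.
have [N N0 hN] : exists2 N : nat, (0 < N)%N & forall x (k : nat), (k < N)%N ->
    0 < complex.Re (h (dilate (k.+1%:R / N%:R) (clamp r x),
                       dilate (k%:R / N%:R) (clamp r x))).
  apply: (@diagonal_subdivision r (fun z => complex.Re (h z))) => //.
    exact: continuous_Ref.
  by move=> x; rewrite h1.
pose p k x := dilate (k%:R / N%:R) (clamp r x).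
pose F x := th + \sum_(k < N) arg_near1 (h (p k.+1 x, p k x)).
have cp k : continuous (p k).
  by apply: continuous_dilate; [exact: continuous_cstf|exact: continuous_clamp].
exists F; split.
- apply: continuous_addf; first exact: continuous_cstf.
  apply: continuous_sumf => k; apply: continuous_arg_near1 => [|x]; last exact: hN.
  by apply: continuous_compf ch; exact: continuous_pairf.
- rewrite /F big1 ?addr0// => k _.
  have p0 j : p j (0, 0) = (0, 0).
    by rewrite /p clamp_id /dilate /= ?mulr0//; split; rewrite /= oppr_le0 r0.
  by rewrite !p0 h1 arg_near1_1.
- move=> x xr.
  suff H n : (n <= N)%N ->
      expi (th + \sum_(k < n) arg_near1 (h (p k.+1 x, p k x))) = f (p n x).
    rewrite /F H// /p divff ?pnatr_eq0 -?lt0n// clamp_id// /dilate !mul1r.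
    by case: (x).
  elim: n => [|n IHn] nN.
    by rewrite big_ord0 addr0 th0 /p mul0r /dilate !mul0r.
  rewrite big_ord_recr /= addrA expiD IHn ?(ltnW nN)// expi_arg_near1.
  - by rewrite /h /= mulrCA -normCK f1 expr1n mulr1.
  - by rewrite /h /= normrM norm_conjC !f1 mulr1.
  - exact: hN.
Qed.

Lemma int_valued_segment (h : R -> R) : continuous h ->
  (forall t, 0 <= t <= 1 -> exists n : int, h t = n%:~R) -> h 1 = h 0.
Proof.
move=> ch hn; apply/eqP; apply/negP => /negP h10.
have [m hm] := hn 0 (introT andP (conj (lexx 0) ler01)).
have [n hn1] := hn 1 (introT andP (conj ler01 (lexx 1))).
have nm : n != m by apply: contra_neq h10 => e; rewrite hm hn1 e.
(* [v] is the half-integer next to [m] on the side of [n]: m + 1/2 if m < n, and m - 1/2 otherwise.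
   The intermediate value theorem makes [h] reach it. *)
pose s : int := if (m < n)%R then 1 else 0.
pose v : R := (m - 1 + s)%:~R + 2^-1.
have [c c01 hc] : exists2 c, c \in `[0, 1] & h c = v.
  apply: IVT => //; first exact: continuous_subspaceT.
  rewrite hm hn1 ge_min le_max /v /s; case: ltP => mn.
    have : m%:~R + 1 <= n%:~R :> R by rewrite -intrD1 ler_int; lia.
    by rewrite subrK => ?; apply/andP; split; apply/orP; [left|right]; lra.
  have : n%:~R + 1 <= m%:~R :> R by rewrite -intrD1 ler_int; lia.
  by rewrite addr0 intrB => ?; apply/andP; split; apply/orP; [right|left]; lra.
have [k hk] : exists k : int, h c = k%:~R by apply: hn; rewrite in_itv in c01.
have : (2 * (k - (m - 1 + s)))%:~R = 1%:~R :> R.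
  by rewrite intrM intrB -hk hc /v addrAC subrr add0r mulfV ?pnatr_eq0.
move=> /eqP; rewrite eqr_int => /eqP; lia.
Qed.

(** Integrality is required on the segment from [x] to [y] only, so that lifts valid on different
    boxes can be compared. *)
Lemma int_valued_const (h : R * R -> R) x y : continuous h ->
  (forall t, 0 <= t <= 1 -> exists n : int,
     h (x.1 + t * (y.1 - x.1), x.2 + t * (y.2 - x.2)) = n%:~R) -> h x = h y.
Proof.
move=> ch hn; case: x y hn => x1 x2 [y1 y2] /= hn.
have := @int_valued_segment (fun t => h (x1 + t * (y1 - x1), x2 + t * (y2 - x2))).
rewrite !mul0r !addr0 !mul1r ![_ + (_ - _)]addrC !subrK => -> //.
apply: continuous_compf ch; apply: continuous_pairf; apply: continuous_addf;
  (try exact: continuous_cstf); apply: continuous_mulf;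
  by [exact: continuous_cstf|exact: continuous_id].
Qed.

(** Box lifts with the same value at the origin agree on common boxes: their difference is
    integer-valued along segments from the origin and vanishes there. Hence the lifts on growing
    boxes glue. *)
Lemma lift_exists (f : R * R -> Cplx R) : continuous f -> (forall x, `|f x| = 1) ->
  exists2 F : R * R -> R, continuous F & forall x, expi (F x) = f x.
Proof.
move=> cf f1.
have [th th0] := expi_surj (f1 (0, 0)).
have /choice[F HF] (n : nat) : exists F : R * R -> R, [/\ continuous F, F (0, 0) = th &
    forall x, in_box n%:R x -> expi (F x) = f x] by exact: box_lift.
have eqF m n x : in_box m%:R x -> in_box n%:R x -> F m x = F n x.
  move=> xm xn; have [cm m0 em] := HF m; have [cn n0 en] := HF n.
  apply/eqP; rewrite -subr_eq0; apply/eqP.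
  rewrite -[LHS](@int_valued_const (fun x => F m x - F n x) (0, 0) x) ?m0 ?n0 ?subrr//.
    by apply: continuous_addf => //; exact: continuous_oppf.
  move=> t t01; rewrite /= !add0r !subr0.
  have em' := em _ (in_box_dilate t01 xm); have en' := en _ (in_box_dilate t01 xn).
  by have [k ->] := expi_inj (etrans em' (esym en')); exists k; rewrite addrAC subrr add0r.
(* The successor puts [x] in the interior of its box, so that near [x] the glued function agrees
   with the single continuous function [F (N x)]. *)
pose N (x : R * R) := (Num.truncn (Num.max `|x.1| `|x.2|)).+1.
have xN x : `|x.1| < (N x)%:R /\ `|x.2| < (N x)%:R.
  have := truncnS_gt (Num.max `|x.1| `|x.2|).
  by rewrite gt_max => /andP.
have boxN x : in_box (N x)%:R x.
  by have [/ltW + /ltW] := xN x; rewrite !ler_norml.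
exists (fun x => F (N x) x) => [x|x]; last first.
  by have [_ _] := HF (N x); apply.
have [cN _ _] := HF (N x); apply: cvg_trans (cN x).
apply: near_eq_cvg.
have b1 : 0 < (N x)%:R - `|x.1| by rewrite subr_gt0; case: (xN x).
have b2 : 0 < (N x)%:R - `|x.2| by rewrite subr_gt0; case: (xN x).
have : nbhs x [set y : R * R | `|y.1| < (N x)%:R /\ `|y.2| < (N x)%:R].
  have c1 : continuous (fun y : R * R => `|y.1|).
    by apply: (continuous_compf (@continuous_fst R R)); exact: norm_continuous.
  have c2 : continuous (fun y : R * R => `|y.2|).
    by apply: (continuous_compf (@continuous_snd R R)); exact: norm_continuous.
  apply: filterI; first exact: (c1 x) (lt_nbhsl (xN x).1).
  exact: (c2 x) (lt_nbhsl (xN x).2).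
apply: filterS => y [/ltW y1 /ltW y2]; apply: eqF => //.
by split; rewrite -ler_norml.
Qed.

End Lifting.

(** * Clock and shift matrices *)

Section ClockShift.
Variables (R : realType) (q : nat).

(** Integer exponents turn inverses into signs and equalities of roots of unity into congruences
    modulo [q] ([zeta_eq]). *)
Definition zeta (k : int) : Cplx R := expi (k%:~R / q%:R).

Lemma zetaD k l : zeta (k + l) = zeta k * zeta l.
Proof. by rewrite /zeta intrD mulrDl expiD. Qed.

Lemma zeta0 : zeta 0 = 1.
Proof. by rewrite /zeta mul0r expi0. Qed.

Lemma zetaN k : zeta (- k) = (zeta k)^-1.
Proof. by rewrite /zeta intrN mulNr expiN. Qed.

Lemma zeta_neq0 k : zeta k != 0.
Proof. exact: expi_neq0. Qed.

Lemma norm_zeta k : `|zeta k| = 1.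
Proof. exact: norm_expi. Qed.

Lemma zetaX k n : zeta k ^+ n = zeta (k * n%:Z).
Proof. by rewrite /zeta expiX intrM mulrA [n%:R * _]mulrC. Qed.

Lemma zeta_eq1 k : (0 < q)%N -> zeta k = 1 <-> (q %| k)%Z.
Proof.
move=> q0; have qR : q%:R != 0 :> R by rewrite pnatr_eq0 -lt0n.
split=> [/expi_eq1[n /(congr1 ( *%R^~ q%:R))]|/dvdzP[n ->]].
  rewrite divfK// -[q%:R]/(q%:Z%:~R) -intrM => /eqP; rewrite eqr_int => /eqP ->.
  exact: dvdz_mull.
by rewrite /zeta intrM mulfK// expi_int.
Qed.

Lemma zeta_eq k l : (0 < q)%N -> zeta k = zeta l <-> (q %| k - l)%Z.
Proof.
move=> q0; rewrite -zeta_eq1// zetaD zetaN.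
by split=> [->|/divr1_eq//]; rewrite divff// zeta_neq0.
Qed.

Lemma U0_exp k : (0 < q)%N ->
  U0 R q ^+ k = \matrix_(i, j) (i + k == j %[mod q])%:R.
Proof.
move=> q0; elim: k => [|k IHk].
  apply/matrixP => i j; rewrite expr0 !mxE addn0 !modn_small//.
rewrite exprS IHk; apply/matrixP => i j.
have l0 : (i.+1 %% q < q)%N by rewrite ltn_pmod.
rewrite -[_ * _]/(_ *m _) !mxE (bigD1 (Ordinal l0))//= big1 ?addr0; last first.
  move=> l /eqP li; rewrite !mxE; case: eqP; rewrite ?mul0r// => il.
  by case: li; apply: val_inj => /=; rewrite il modn_small.
by rewrite !mxE /= modn_mod eqxx mul1r modnDml addSnnS.
Qed.

Lemma U0q : (0 < q)%N -> U0 R q ^+ q = 1.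
Proof.
move=> q0; rewrite U0_exp//; apply/matrixP => i j.
by rewrite !mxE modnDr !modn_small.
Qed.

Lemma conj_nat n : Num.conj n%:R = n%:R :> Cplx R.
Proof. exact: conjc_nat. Qed.

Lemma U0_unitary : (0 < q)%N -> U0 R q *m (map_mx Num.conj (U0 R q))^T = 1%:M.
Proof.
move=> q0; apply/matrixP => i j.
have l0 : (i.+1 %% q < q)%N by rewrite ltn_pmod.
rewrite !mxE (bigD1 (Ordinal l0))//= big1 ?addr0; last first.
  move=> l /eqP li; rewrite !mxE; case: eqP; rewrite ?mul0r// => il.
  by case: li; apply: val_inj => /=; rewrite il modn_small.
rewrite !mxE /= modn_mod eqxx mul1r conj_nat; congr (_%:R).
rewrite eq_sym -(addn1 i) -(addn1 j) eqn_modDr !modn_small//.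
Qed.

Variable p : nat.
Let w := zeta p.

Lemma V0E : V0 R p q = diag_mx (\row_(j < q) (w ^+ j)).
Proof.
by rewrite /V0; congr diag_mx; apply/rowP => j; rewrite !mxE /w /zeta /expi mulrA.
Qed.

Lemma V0_exp k : V0 R p q ^+ k = diag_mx (\row_(j < q) (w ^+ (j * k))).
Proof.
rewrite V0E; elim: k => [|k IHk].
  by apply/matrixP => i j; rewrite expr0 !mxE muln0 expr0.
rewrite exprS IHk -[_ * _]/(_ *m _) mulmx_diag; congr diag_mx; apply/rowP => j.
by rewrite !mxE -exprD mulnS.
Qed.

Lemma wq1 : (0 < q)%N -> w ^+ q = 1.
Proof. by move=> q0; rewrite zetaX; apply/zeta_eq1 => //; exact: dvdz_mull. Qed.

Lemma V0q : (0 < q)%N -> V0 R p q ^+ q = 1.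
Proof.
move=> q0; rewrite V0_exp; apply/matrixP => i j; rewrite !mxE.
by rewrite mulnC exprM wq1// expr1n.
Qed.

Lemma V0_unitary : V0 R p q *m (map_mx Num.conj (V0 R p q))^T = 1%:M.
Proof.
rewrite V0E; apply/matrixP => i j; rewrite mul_diag_mx !mxE.
have [->|ij] := eqVneq; last by rewrite !mulr0n rmorph0 mulr0.
by rewrite !mulr1n -normCK normrX norm_zeta !expr1n.
Qed.

Lemma U0V0 : (0 < q)%N -> U0 R q *m V0 R p q = w *: (V0 R p q *m U0 R q).
Proof.
move=> q0; rewrite V0E; apply/matrixP => i j.
rewrite mul_mx_diag mul_diag_mx !mxE.
case: eqP => [ij|]; last by rewrite mul0r !mulr0.
rewrite mul1r mulr1 -exprS -[in LHS](modn_small (ltn_ord j)) -ij.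
by rewrite [in RHS](divn_eq i.+1 q) exprD mulnC exprM wq1// expr1n mul1r.
Qed.

End ClockShift.

(** * Quasi-periodicity of the rotation algebras *)

Section MatrixAdjoint.
Variables (R : realType) (q : nat).
Implicit Types A B W : 'M[Cplx R]_q.

Definition mxstar A : 'M[Cplx R]_q := (map_mx Num.conj A)^T.

Lemma mxstarM A B : mxstar (A *m B) = mxstar B *m mxstar A.
Proof. by rewrite /mxstar map_mxM trmx_mul. Qed.

Lemma mxstarZ c A : mxstar (c *: A) = Num.conj c *: mxstar A.
Proof. by rewrite /mxstar map_mxZ linearZ. Qed.

Lemma mxstar1 : mxstar 1%:M = 1%:M.
Proof. by rewrite /mxstar map_mx1 trmx1. Qed.

Lemma mxstar_scalar c : mxstar c%:M = (Num.conj c)%:M.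
Proof. by rewrite /mxstar map_scalar_mx tr_scalar_mx. Qed.

Lemma unitary_exp A k : A *m mxstar A = 1%:M -> (A ^+ k) *m mxstar (A ^+ k) = 1%:M.
Proof.
move=> A1; elim: k => [|k IHk]; first by rewrite expr0 -[1]/(1%:M) mxstar1 mulmx1.
rewrite exprS -[A * _]/(A *m _) mxstarM mulmxA -(mulmxA A) IHk mulmx1.
exact: A1.
Qed.

(** Unitarity of [W] lets the relation pass to adjoints; this is what makes quasi-periodicity stable
    under [mfstar]. *)
Lemma unitary_intertwine W A B : W *m mxstar W = 1%:M ->
  W *m A = B *m W -> W *m mxstar A = mxstar B *m W.
Proof.
move=> W1 /(congr1 mxstar); rewrite !mxstarM => e.
have W1' := mulmx1C W1.
by rewrite -[LHS]mulmx1 -W1' mulmxA -(mulmxA W) e !mulmxA W1 mul1mx.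
Qed.

Lemma exp_twistr (F : fieldType) n (w : F) (u v : 'M[F]_n) k :
  u *m v = w *: (v *m u) -> u *m (v ^+ k) = w ^+ k *: ((v ^+ k) *m u).
Proof.
move=> uv; elim: k => [|k IHk]; first by rewrite !expr0 scale1r mul1mx mulmx1.
rewrite exprS -[v * _]/(v *m _) mulmxA uv -scalemxAl -mulmxA IHk -scalemxAr.
by rewrite scalerA -exprS mulmxA.
Qed.

Lemma scale_twist (F : fieldType) n (w a b : F) (u v : 'M[F]_n) :
  u *m v = w *: (v *m u) -> (a *: u) *m (b *: v) = w *: ((b *: v) *m (a *: u)).
Proof.
move=> uv; rewrite -!scalemxAl -!scalemxAr uv !scalerA.
by congr (_ *: _); ring.
Qed.

Lemma entry_mulmx_bound (W A : 'M[Cplx R]_q) (e : Cplx R) :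
  (forall i j, `|A i j| <= e) ->
  forall i j, `|(W *m A) i j| <= (\sum_k `|W i k|) * e.
Proof.
move=> Ae i j; rewrite mxE (le_trans (ler_norm_sum _ _ _))// mulr_suml.
by apply: ler_sum => k _; rewrite normrM ler_wpM2l.
Qed.

Lemma entry_mulmxr_bound (W A : 'M[Cplx R]_q) (e : Cplx R) :
  (forall i j, `|A i j| <= e) ->
  forall i j, `|(A *m W) i j| <= e * (\sum_k `|W k j|).
Proof.
move=> Ae i j; rewrite mxE (le_trans (ler_norm_sum _ _ _))// mulr_sumr.
by apply: ler_sum => k _; rewrite normrM ler_wpM2r.
Qed.

Lemma norm_small_eq0 (z C : Cplx R) :
  (forall e : R, 0 < e -> `|z| <= C * e%:C) -> z = 0.
Proof.
move=> ze; apply/eqP; rewrite -normr_eq0; apply/negPn/negP => z0.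
(* The value e = 1 shows that [C] is positive, in particular real; then e = |z| / (2 C) gives |z| <=
   |z| / 2. *)
have /ze z1 := @ltr01 R; rewrite mulr1 in z1.
have C0 : 0 < C by apply: lt_le_trans z1; rewrite lt_def z0 normr_ge0.
have [c cE] : exists c, C = c%:C by apply/complex_realP; exact: gtr0_real.
have [t tE] : exists t, `|z| = t%:C by apply/complex_realP; exact: normr_real.
have t0 : 0 < t by rewrite -ltcR -tE lt_def z0 normr_ge0.
have c0 : 0 < c by rewrite -ltcR -cE.
have := ze (t / (2 * c)) (divr_gt0 t0 (mulr_gt0 _ c0)).
rewrite ltr0n => /(_ isT); rewrite tE cE -rmorphM lecR.
have -> : c * (t / (2 * c)) = t / 2 by field; rewrite gt_eqF.
by apply/negP; rewrite -ltNge; lra.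
Qed.

End MatrixAdjoint.

(** * Periodic functions and uniform limits *)

Section PeriodicAlgebra.
Variables (R : realType) (q : nat).
Implicit Types (a b : matfun R q).

Lemma periodic_zero : periodic_alg R q 0.
Proof. by split => [|x1 x2]; [exact: continuous_cstmx|split]. Qed.

Lemma periodic_add a b : periodic_alg R q a -> periodic_alg R q b ->
  periodic_alg R q (a + b).
Proof.
move=> [ca pa] [cb pb]; split; first exact: (continuous_addmx ca cb).
by move=> x1 x2; rewrite !fctE; have [-> ->] := pa x1 x2; have [-> ->] := pb x1 x2.
Qed.

Lemma periodic_scale (c : Cplx R) a : periodic_alg R q a -> periodic_alg R q (c *: a).
Proof.
move=> [ca pa]; split.
  by apply: (@continuous_scalemx _ _ _ _ (fun=> c)) => //; exact: continuous_cstf.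
by move=> x1 x2; rewrite !fctE; have [-> ->] := pa x1 x2.
Qed.

Lemma periodic_opp a : periodic_alg R q a -> periodic_alg R q (- a).
Proof. by rewrite -scaleN1r; exact: periodic_scale. Qed.

Lemma periodic_mul a b : periodic_alg R q a -> periodic_alg R q b ->
  periodic_alg R q (mfmul a b).
Proof.
move=> [ca pa] [cb pb]; split; first exact: (continuous_mulmx ca cb).
by move=> x1 x2; rewrite /mfmul; have [-> ->] := pa x1 x2; have [-> ->] := pb x1 x2.
Qed.

Lemma periodic_star a : periodic_alg R q a -> periodic_alg R q (mfstar a).
Proof.
move=> [ca pa]; split; last first.
  by move=> x1 x2; rewrite /mfstar; have [-> ->] := pa x1 x2.
move: ca => /continuous_mxP ca; apply/continuous_mxP => i j.
rewrite (_ : (fun x => _) = fun x => Num.conj (a x j i)).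
  exact: (continuous_conj (ca j i)).
by apply/funext => x; rewrite !mxE.
Qed.

Lemma Cstar_opp (S : set (matfun R q)) a : Cstar_subalgebra S -> S a -> S (- a).
Proof. by move=> CS Sa; rewrite -scaleN1r; exact: (Cstar_scale CS). Qed.

Lemma Cstar_sub2 (S : set (matfun R q)) a b :
  Cstar_subalgebra S -> S a -> S b -> S (a - b).
Proof. by move=> CS Sa Sb; apply: (Cstar_add CS) => //; exact: Cstar_opp. Qed.

Lemma Cstar_uniform_closed (S : set (matfun R q)) a :
  Cstar_subalgebra S -> periodic_alg R q a ->
  (forall e : R, 0 < e -> exists2 b, S b & forall x i j, `|a x i j - b x i j| <= e%:C) ->
  S a.
Proof.
move=> CS pa ha; apply: (Cstar_closed CS pa) => e e0.
pose k : R := q%:R ^+ 2.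
have k0 : 0 <= k by rewrite exprn_ge0.
(* The [+ 1] makes the resulting bound k e / (k + 1) strictly smaller than [e]. *)
have [b Sb hb] : exists2 b, S b & forall x i j, `|a x i j - b x i j| <= (e / (k + 1))%:C.
  by apply: ha; rewrite divr_gt0// ltr_wpDl.
exists b => //; apply: le_lt_trans (@opnorm_le _ _ _ (e / (k + 1)) _ _) _.
- by rewrite divr_ge0 ?ltW// ltr_wpDl.
- by move=> x i j; rewrite !fctE !mxE.
- rewrite lte_fin -/k mulrA ltr_pdivrMr ?ltr_wpDl//.
  by rewrite mulrC ltr_pM2l// ltrDl.
Qed.

Lemma periodic_approx (S : set (matfun R q)) a :
  S `<=` periodic_alg R q -> periodic_alg R q a ->
  (forall e : R, 0 < e -> exists2 b, S b & (opnorm (a - b)%R < e%:E)%E) ->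
  forall e : R, 0 < e -> exists2 b, S b & forall x i j, `|a x i j - b x i j| <= e%:C.
Proof.
move=> Sp pa ha e e0; have [b Sb hb] := ha e e0; exists b => // x i j.
have [cab _] : periodic_alg R q (a - b).
  by apply: periodic_add => //; apply: periodic_opp; exact: Sp.
by have := opnorm_ge cab hb x i j; rewrite !fctE !mxE.
Qed.

End PeriodicAlgebra.

(** * The generators and their behaviour under unit translations *)

Section RotationAlgebra.
Variables (R : realType) (p q : nat).
Hypothesis q0 : (0 < q)%N.
Implicit Types (a b : matfun R q).

Lemma UfunE x : @Ufun R q x = expi (x.1 / q%:R) *: U0 R q.
Proof. by rewrite /Ufun /expi mulrA. Qed.

Lemma VfunE x : @Vfun R p q x = expi (x.2 / q%:R) *: V0 R p q.
Proof. by rewrite /Vfun /expi mulrA. Qed.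

Lemma expi_shift (t : R) : expi ((t + 1) / q%:R) = zeta R q 1 * expi (t / q%:R).
Proof. by rewrite mulrDl expiD mulrC. Qed.

Lemma expi_period (t : R) : expi ((t + q%:R) / q%:R) = expi (t / q%:R).
Proof. by rewrite mulrDl divff ?pnatr_eq0 -?lt0n// expiD (expi_nat _ 1) mulr1. Qed.

Lemma Ufun_periodic : periodic_alg R q (@Ufun R q).
Proof.
split=> [|x1 x2]; last by rewrite !UfunE /= expi_period.
rewrite (_ : @Ufun R q = fun x => expi (x.1 / q%:R) *: U0 R q); last first.
  by apply/funext => x; rewrite UfunE.
apply: continuous_scalemx; last exact: continuous_cstmx.
apply: continuous_expi; apply: continuous_mulf; last exact: continuous_cstf.
exact: continuous_fst.
Qed.

Lemma Vfun_periodic : periodic_alg R q (@Vfun R p q).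
Proof.
split=> [|x1 x2]; last by rewrite !VfunE /= expi_period.
rewrite (_ : @Vfun R p q = fun x => expi (x.2 / q%:R) *: V0 R p q); last first.
  by apply/funext => x; rewrite VfunE.
apply: continuous_scalemx; last exact: continuous_cstmx.
apply: continuous_expi; apply: continuous_mulf; last exact: continuous_cstf.
exact: continuous_snd.
Qed.

(** Intertwining relations are linear and survive limits. The two translations are oriented
    oppositely so that clock and shift matrices can enter with the same positive exponent [r]. *)
Definition quasi_periodic (W1 W2 : 'M[Cplx R]_q) : set (matfun R q) :=
  [set a | periodic_alg R q a /\ forall x1 x2 : R,
     W1 *m a (x1 + 1, x2) = a (x1, x2) *m W1 /\
     W2 *m a (x1, x2) = a (x1, x2 + 1) *m W2].

Lemma intertwine_closed (W : 'M[Cplx R]_q) (S : set (matfun R q)) a (x y : R * R) :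
  (forall e : R, 0 < e -> exists2 b, S b & forall x i j, `|a x i j - b x i j| <= e%:C) ->
  (forall b, S b -> W *m b x = b y *m W) ->
  W *m a x = a y *m W.
Proof.
move=> ha hS; apply/matrixP => i j; apply/eqP; rewrite -subr_eq0; apply/eqP.
apply: (@norm_small_eq0 _ _ (\sum_k `|W i k| + \sum_k `|W k j|)) => e e0.
have [b Sb hb] := ha e e0.
have -> : (W *m a x) i j - (a y *m W) i j =
    (W *m (a x - b x)) i j - ((a y - b y) *m W) i j.
  rewrite mulmxBr mulmxBl (hS b Sb).
  by move: (W *m a x) (a y *m W) (b y *m W) => A B C; rewrite !mxE; ring.
rewrite (le_trans (ler_normB _ _))// mulrDl lerD//.
  apply: entry_mulmx_bound => k l; rewrite mxE [X in _ + X]mxE; exact: hb.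
rewrite mulrC; apply: entry_mulmxr_bound => k l.
by rewrite mxE [X in _ + X]mxE; exact: hb.
Qed.

Lemma quasi_periodic_Cstar (W1 W2 : 'M[Cplx R]_q) :
  W1 *m mxstar W1 = 1%:M -> W2 *m mxstar W2 = 1%:M ->
  Cstar_subalgebra (quasi_periodic W1 W2).
Proof.
move=> uW1 uW2; split.
- by move=> a [].
- split; first exact: periodic_zero.
  move=> x1 x2; have z x : (0 : matfun R q) x = 0 by [].
  by rewrite !z !mulmx0 !mul0mx.
- move=> a b [pa ha] [pb hb]; split; first exact: periodic_add.
  move=> x1 x2; rewrite !fctE !mulmxDr !mulmxDl.
  by have [-> ->] := ha x1 x2; have [-> ->] := hb x1 x2.
- move=> c a [pa ha]; split; first exact: periodic_scale.
  move=> x1 x2; rewrite !fctE -!scalemxAr -!scalemxAl.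
  by have [-> ->] := ha x1 x2.
- move=> a b [pa ha] [pb hb]; split; first exact: periodic_mul.
  move=> x1 x2; rewrite /mfmul !mulmxA.
  have [-> ->] := ha x1 x2; rewrite -!mulmxA.
  by have [-> ->] := hb x1 x2.
- move=> a [pa ha]; split; first exact: periodic_star.
  move=> x1 x2; have [h1 h2] := ha x1 x2.
  by split; exact: unitary_intertwine.
- move=> a pa ha; split => // x1 x2.
  have /periodic_approx/(_ pa ha) {}ha : quasi_periodic W1 W2 `<=` periodic_alg R q.
    by move=> b [].
  by split; apply: intertwine_closed ha _ => b [_ /(_ x1 x2)[]].
Qed.

Lemma periodic_Cstar : Cstar_subalgebra (periodic_alg R q).
Proof.
by split => //; [exact: periodic_zero|exact: periodic_add|exact: periodic_scale
  |exact: periodic_mul|exact: periodic_star].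
Qed.

Lemma rotation_minimal (S : set (matfun R q)) : Cstar_subalgebra S ->
  S (@Ufun R q) -> S (@Vfun R p q) -> rotation_alg R p q `<=` S.
Proof.
move=> CS SU SV a; apply; split => // b [->|->] //.
Qed.

Lemma rotation_U : rotation_alg R p q (@Ufun R q).
Proof. by move=> S [_]; apply; left. Qed.

Lemma rotation_V : rotation_alg R p q (@Vfun R p q).
Proof. by move=> S [_]; apply; right. Qed.

Lemma rotation_Cstar : Cstar_subalgebra (rotation_alg R p q).
Proof.
split.
- apply: rotation_minimal; first exact: periodic_Cstar.
    exact: Ufun_periodic.
  exact: Vfun_periodic.
- by move=> S [CS _]; exact: (Cstar_zero CS).
- by move=> a b Aa Ab S SP; case: (SP) => CS _; apply: (Cstar_add CS); [exact: Aa|exact: Ab].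
- by move=> c a Aa S SP; case: (SP) => CS _; apply: (Cstar_scale CS); exact: Aa.
- by move=> a b Aa Ab S SP; case: (SP) => CS _; apply: (Cstar_mul CS); [exact: Aa|exact: Ab].
- by move=> a Aa S SP; case: (SP) => CS _; apply: (Cstar_star CS); exact: Aa.
- move=> a pa ha S SP; case: (SP) => CS _; apply: (Cstar_closed CS pa) => e e0.
  by have [b Ab hb] := ha e e0; exists b => //; exact: Ab.
Qed.

Lemma Ufun_unitary : mfmul (@Ufun R q) (mfstar (@Ufun R q)) = fun=> 1%:M.
Proof.
apply/funext => x; rewrite /mfmul /mfstar -/(mxstar _) UfunE mxstarZ.
by rewrite -scalemxAl -scalemxAr scalerA -normCK norm_expi expr1n scale1r U0_unitary.
Qed.

Lemma Vfun_unitary : mfmul (@Vfun R p q) (mfstar (@Vfun R p q)) = fun=> 1%:M.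
Proof.
apply/funext => x; rewrite /mfmul /mfstar -/(mxstar _) VfunE mxstarZ.
by rewrite -scalemxAl -scalemxAr scalerA -normCK norm_expi expr1n scale1r V0_unitary.
Qed.

Lemma rotation_1 : rotation_alg R p q (fun=> 1%:M).
Proof.
rewrite -Ufun_unitary; apply: (Cstar_mul rotation_Cstar); first exact: rotation_U.
by apply: (Cstar_star rotation_Cstar); exact: rotation_U.
Qed.

Lemma UV_twist x :
  @Ufun R q x *m @Vfun R p q x = zeta R q p *: (@Vfun R p q x *m @Ufun R q x).
Proof.
by rewrite UfunE VfunE; apply: scale_twist; exact: U0V0.
Qed.

Variable r : nat.
Hypothesis pr : (q %| p%:Z * r%:Z - 1)%Z.

Lemma zeta_pr : zeta R q p ^+ r = zeta R q 1.
Proof. by rewrite zetaX; apply/zeta_eq. Qed.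

(** Since p r = 1 modulo q, conjugation by V0^r in the right direction multiplies U0 by exactly
    exp(2 pi i / q), the factor that [Ufun] acquires under a unit translation; U0^r does the same
    for [Vfun]. *)
Lemma rotation_quasi_periodic :
  rotation_alg R p q `<=` quasi_periodic (V0 R p q ^+ r) (U0 R q ^+ r).
Proof.
apply: rotation_minimal.
- by apply: quasi_periodic_Cstar; apply: unitary_exp;
    [exact: V0_unitary|exact: U0_unitary].
- split; first exact: Ufun_periodic.
  move=> x1 x2; rewrite !UfunE /= expi_shift; split.
    rewrite -[LHS]scalemxAr -[RHS]scalemxAl (exp_twistr r (U0V0 R p q0)) zeta_pr.
    by rewrite scalerA mulrC.
  rewrite -[LHS]scalemxAr -[RHS]scalemxAl; congr (_ *: _).
  exact/esym/(commrX r (commr_refl (U0 R q))).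
- split; first exact: Vfun_periodic.
  move=> x1 x2; rewrite !VfunE /= expi_shift; split.
    rewrite -[LHS]scalemxAr -[RHS]scalemxAl; congr (_ *: _).
    exact/esym/(commrX r (commr_refl (V0 R p q))).
  rewrite -[LHS]scalemxAr -[RHS]scalemxAl.
  have e : U0 R q ^+ r *m V0 R p q = zeta R q 1 *: (V0 R p q *m U0 R q ^+ r).
    by rewrite -zeta_pr; exact: (exp_twist r (U0V0 R p q0)).
  by rewrite e scalerA mulrC.
Qed.

End RotationAlgebra.

(** * Transport of a twisted pair over the unit square *)

Section Monodromy.
Variables (R : realType) (q : nat).
Hypothesis q0 : (0 < q)%N.
Implicit Types (u v T : R * R -> 'M[Cplx R]_q).

Lemma continuous_twisted_avg (S : topologicalType) (u' u X : S -> 'M[Cplx R]_q) :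
  continuous u' -> continuous u -> continuous X ->
  continuous (fun z => twisted_avg (u' z) (u z) (X z)).
Proof.
move=> cu' cu cX.
apply: (@continuous_summx S _ q q 'I_q (index_enum _)
  (fun j z => u' z ^+ j *m X z *m u z ^+ (q - j))) => j.
exact: (continuous_mulmx (continuous_mulmx (continuous_expmx cu') cX)
  (continuous_expmx cu)).
Qed.

Lemma conj_pos (c : Cplx R) : c != 0 -> 0 < complex.Re (c * Num.conj c).
Proof.
move=> c0; rewrite -ltcR RRe_real; last by rewrite -normCK realX ?normr_real.
by rewrite -normCK exprn_gt0// normr_gt0.
Qed.

(** [T x] is a product of averaged intertwiners between consecutive points of the segment from the
    origin to the clamped [x]. A factor is invertible when its two points are close, and
    [diagonal_subdivision] makes one number of steps serve the whole box. *)
Lemma transport_exists u v (w : Cplx R) : w ^+ q = 1 ->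
  continuous u -> continuous v ->
  (forall x, u x ^+ q = 1) -> (forall x, v x ^+ q = 1) ->
  (forall x, u x * v x = w *: (v x * u x)) ->
  exists T, [/\ continuous T, T (0, 0) = 1%:M, forall x, \det (T x) != 0 &
    forall x, in_box 1 x -> u x *m T x = T x *m u (0, 0) /\
                            v x *m T x = T x *m v (0, 0)].
Proof.
move=> w1 cu cv u1 v1 uv.
have qC : (q%:R * q%:R : Cplx R) != 0 by rewrite mulf_neq0 ?pnatr_eq0 -?lt0n.
pose S (z : (R * R) * (R * R)) : 'M[Cplx R]_q :=
  (q%:R * q%:R)^-1 *: intertwiner (u z.1) (v z.1) (u z.2) (v z.2).
have c1 (a : matfun R q) : continuous a -> continuous (fun z : (R * R) * (R * R) => a z.1).
  by move=> ca; apply: continuous_compf ca; exact: continuous_fst.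
have c2 (a : matfun R q) : continuous a -> continuous (fun z : (R * R) * (R * R) => a z.2).
  by move=> ca; apply: continuous_compf ca; exact: continuous_snd.
have cS : continuous S.
  exact: (continuous_scalemx (@continuous_cstf _ _ (q%:R * q%:R)^-1)
    (continuous_twisted_avg (c1 _ cu) (c2 _ cu) (continuous_twisted_avg
      (c1 _ cv) (c2 _ cv) (@continuous_cstmx _ _ _ _ 1)))).
have S1 x : S (x, x) = 1%:M.
  by rewrite /S /= intertwiner_diag// scale_scalar_mx mulVf.
have SP z : u z.1 *m S z = S z *m u z.2 /\ v z.1 *m S z = S z *m v z.2.
  have [h1 h2] := intertwinerP w1 (uv z.2) (uv z.1) (u1 _) (v1 _) (u1 _) (v1 _).
  by rewrite /S -!scalemxAr -!scalemxAl; split; congr (_ *: _).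
pose D z : R := complex.Re (\det (S z) * Num.conj (\det (S z))).
have [N N0 hN] : exists2 N : nat, (0 < N)%N & forall x (k : nat), (k < N)%N ->
    0 < D (dilate (k.+1%:R / N%:R) (clamp 1 x), dilate (k%:R / N%:R) (clamp 1 x)).
  apply: diagonal_subdivision.
  - exact: ler01.
  - apply: continuous_Ref; apply: continuous_mulf; first exact: continuous_det.
    by apply: continuous_conj; exact: continuous_det.
  - by move=> x; rewrite /D S1 conj_pos// det1 oner_neq0.
pose y (k : nat) (x : R * R) := dilate (k%:R / N%:R) (clamp 1 x).
have cy k : continuous (y k).
  by apply: continuous_dilate; [exact: continuous_cstf|exact: continuous_clamp].
pose T := fix T (k : nat) (x : R * R) : 'M[Cplx R]_q :=
  if k is k'.+1 then S (y k x, y k' x) *m T k' x else 1%:M.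
have cT k : continuous (T k).
  elim: k => [|k IHk]; first exact: continuous_cstmx.
  exact: (continuous_mulmx (continuous_compf (continuous_pairf (cy _) (cy _)) cS) IHk).
have dT k x : (k <= N)%N -> \det (T k x) != 0.
  elim: k => [|k IHk] kN; first by rewrite det1 oner_neq0.
  rewrite /= det_mulmx mulf_neq0 ?IHk ?(ltnW kN)//.
  by have := hN x k kN; rewrite /D; apply: contraTneq => ->; rewrite mul0r ltxx.
have yx0 x : y 0%N x = (0, 0) by rewrite /y mul0r /dilate !mul0r.
have TP k x : u (y k x) *m T k x = T k x *m u (0, 0) /\
              v (y k x) *m T k x = T k x *m v (0, 0).
  elim: k => [|k [IHu IHv]]; first by rewrite yx0 !mulmx1 !mul1mx.
  have [Su Sv] := SP (y k.+1 x, y k x).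
  by rewrite /= !mulmxA Su Sv -!mulmxA IHu IHv.
exists (T N); split; first exact: cT.
- have y0 k : y k (0, 0) = (0, 0).
    by rewrite /y clamp_id /dilate /= ?mulr0//; split; rewrite /= oppr_le0 ler01.
  by elim: (N) => //= k ->; rewrite !y0 S1 mulmx1.
- by move=> x; exact: dT.
- move=> x xb; have := TP N x.
  by rewrite /y divff ?pnatr_eq0 -?lt0n// clamp_id// /dilate !mul1r; case: (x).
Qed.

Lemma unimodular_lift (h : R * R -> Cplx R) : continuous h -> (forall x, h x != 0) ->
  exists2 L : R * R -> R, continuous L & forall x, h x = `|h x| * expi (L x).
Proof.
move=> ch h0.
have cn : continuous (fun x => `|h x| : Cplx R).
  by apply: (continuous_compf ch); exact: norm_continuous.
have [L cL LP] : exists2 L : R * R -> R, continuous L &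
    forall x, expi (L x) = h x / `|h x|.
  apply: lift_exists => [|x]; last first.
    by rewrite normrM normfV normr_id divff// normr_eq0.
  have cV : continuous (fun x => `|h x|^-1 : Cplx R).
    by move=> x; apply: (@cvgV (Cplx R)); [rewrite normr_eq0|exact: cn].
  exact: (continuous_mulf ch cV).
by exists L => // x; rewrite LP mulrC divfK// normr_eq0.
Qed.

(** The transport is divided by a continuous q-th root of the phase of its determinant, which exists
    because that phase has a continuous logarithm on the plane. *)
Lemma positive_transport u v (w : Cplx R) : w ^+ q = 1 ->
  continuous u -> continuous v ->
  (forall x, u x ^+ q = 1) -> (forall x, v x ^+ q = 1) ->
  (forall x, u x * v x = w *: (v x * u x)) ->
  exists T, [/\ continuous T, T (0, 0) = 1%:M, forall x, 0 < \det (T x) &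
    forall x, in_box 1 x -> u x *m T x = T x *m u (0, 0) /\
                            v x *m T x = T x *m v (0, 0)].
Proof.
move=> w1 cu cv u1 v1 uv.
have [T [cT T0 dT TP]] := transport_exists w1 cu cv u1 v1 uv.
have [L cL LP] := unimodular_lift (continuous_det cT) dT.
(* Subtracting [L (0, 0)], which is an integer, keeps the value 1 at the origin without changing the
   phase of the determinant. *)
pose h x := - (L x - L (0, 0)) / q%:R.
have eL0 : expi (L (0, 0)) = 1.
  by have := LP (0, 0); rewrite T0 det1 normr1 mul1r.
have ch : continuous h.
  apply: continuous_mulf; last exact: continuous_cstf.
  apply: continuous_oppf; apply: continuous_addf => //; exact: continuous_cstf.
exists (fun x => expi (h x) *: T x); split.
- exact: (continuous_scalemx (continuous_expi ch) cT).
- by rewrite T0 /h subrr oppr0 mul0r expi0 scale1r.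
- move=> x; rewrite detZ expiX.
  have -> : q%:R * h x = - (L x - L (0, 0)).
    by rewrite /h mulrC divfK// pnatr_eq0 -lt0n.
  rewrite mulrC LP -mulrA -expiD opprB addrC -addrA addNr addr0 eL0 mulr1.
  by rewrite normr_gt0.
- by move=> x /TP[h1 h2]; rewrite -!scalemxAr -!scalemxAl h1 h2.
Qed.

Definition clamp01 (t : R) : R := Num.max 0 (Num.min 1 t).

Lemma clamp01_in t : 0 <= clamp01 t <= 1.
Proof. by rewrite /clamp01 le_max lexx ge_max ge_min lexx ler01. Qed.

Lemma clamp01_id t : 0 <= t <= 1 -> clamp01 t = t.
Proof. by move=> /andP[t0 t1]; rewrite /clamp01 min_r// max_r. Qed.

Lemma continuous_clamp01 : continuous clamp01.
Proof.
apply: (@max_fun_continuous _ _ R (fun _ : R => 0) (fun t : R => Num.min 1 t)).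
  exact: continuous_cstf.
apply: (@min_fun_continuous _ _ R (fun _ : R => 1) id); first exact: continuous_cstf.
exact: continuous_id.
Qed.

(** By Schur's lemma Y(0)^(-1) Y(t) is a scalar l(t). The determinants of all Y(t) share the phase
    of [k], so l(t)^q > 0; the phase of l(t) is then a q-th root of unity, constant by continuity
    and equal to 1 at t = 0. *)
Lemma positive_holonomy (u0 v0 : 'M[Cplx R]_q) (w al be k : Cplx R)
    (Y : R -> 'M[Cplx R]_q) :
  q.-primitive_root w -> u0 \in unitmx -> v0 \in unitmx ->
  u0 *m v0 = w *: (v0 *m u0) -> k != 0 -> continuous Y ->
  (forall t : R, 0 <= t <= 1 -> Y t *m u0 = al *: (u0 *m Y t) /\
                            Y t *m v0 = be *: (v0 *m Y t)) ->
  (forall t : R, 0 <= t <= 1 -> 0 < \det (Y t) / k) ->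
  exists2 l : Cplx R, 0 < l & Y 1 = l *: Y 0.
Proof.
move=> wq uu uv uv0 k0 cY YP Yk.
have Yu t : 0 <= t <= 1 -> Y t \in unitmx.
  move=> /Yk; rewrite unitmxE unitfE; apply: contraTneq => ->.
  by rewrite mul0r ltxx.
have t0 : 0 <= (0 : R) <= 1 by rewrite lexx ler01.
have t1 : 0 <= (1 : R) <= 1 by rewrite lexx ler01.
pose Z t := invmx (Y 0) *m Y t.
have Zs t : 0 <= t <= 1 -> exists l, Z t = l%:M.
  move=> tI; have [u00 v00] := YP 0 t0; have [ut vt] := YP t tI.
  by apply: (twisted_commutant wq uu uv uv0);
    [exact: (twisted_ratio_comm (Yu _ t0) u00 ut)
    |exact: (twisted_ratio_comm (Yu _ t0) v00 vt)].
pose i0 : 'I_q := Ordinal q0.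
(* Clamping makes [l] nonzero on the whole line, as the polar lift requires, while the relations are
   known on [0, 1]. *)
pose l t := Z (clamp01 t) i0 i0.
have lP t : 0 <= t <= 1 -> Z t = (l t)%:M.
  by move=> tI; have [c cE] := Zs t tI; rewrite /l clamp01_id// cE mxE eqxx mulr1n.
have cl : continuous l.
  have /continuous_mxP cZ : continuous Z.
    exact: (continuous_mulmx (@continuous_cstmx _ _ _ _ _) cY).
  exact: (continuous_compf continuous_clamp01 (cZ i0 i0)).
have lq t : 0 <= t <= 1 -> 0 < l t ^+ q.
  move=> tI; have -> : l t ^+ q = \det (Z t) by rewrite lP// det_scalar.
  rewrite /Z det_mulmx det_inv.
  have -> : (\det (Y 0))^-1 * \det (Y t) = (\det (Y t) / k) / (\det (Y 0) / k).
    by rewrite invf_div mulrA divfK// mulrC.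
  by rewrite divr_gt0 ?Yk.
have lc t : l t = l (clamp01 t).
  by rewrite /l (clamp01_id (clamp01_in t)).
have l0 t : l t != 0.
  rewrite lc; apply: contraTneq (lq _ (clamp01_in t)) => ->.
  by rewrite expr0n gtn_eqF// ltxx.
have [L cL LP] : exists2 L : R * R -> R, continuous L &
    forall x, l x.1 = `|l x.1| * expi (L x).
  apply: (@unimodular_lift (fun x => l x.1)) => // .
  by apply: (continuous_compf (@continuous_fst R R)).
have qL t : exists n : int, q%:R * L (t, 0) = n%:~R.
  apply: expi_eq1; rewrite -expiX.
  have lq' := lq _ (clamp01_in t); rewrite -lc in lq'.
  have n0 : `|l t| ^+ q != 0 by rewrite expf_neq0// normr_eq0.
  apply: (mulfI n0); rewrite -exprMn -(LP (t, 0)) /= mulr1.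
  by rewrite -normrX gtr0_norm.
have Lc : q%:R * L (1, 0) = q%:R * L (0, 0).
  apply: (@int_valued_segment R (fun t => q%:R * L (t, 0))) => [|t _]; last exact: qL.
  apply: continuous_mulf; first exact: continuous_cstf.
  apply: continuous_compf cL; apply: continuous_pairf; last exact: continuous_cstf.
  exact: continuous_id.
have l00 : l 0 = 1.
  have := lP 0 t0; rewrite /Z mulVmx ?Yu// => /matrixP/(_ i0 i0).
  by rewrite !mxE eqxx !mulr1n.
have l1 : l 1 = `|l 1|.
  have := LP (1, 0); rewrite /= (mulfI _ Lc) ?pnatr_eq0 -?lt0n//.
  by have := LP (0, 0); rewrite /= l00 normr1 mul1r => <-; rewrite mulr1.
exists (l 1); first by rewrite l1 normr_gt0.
by rewrite -(mulKVmx (Yu _ t0) (Y 1)) -/(Z 1) lP// mul_mx_scalar.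
Qed.

End Monodromy.

(** * Holonomy along the sides of the unit square *)

Section Holonomy.
Variables (R : realType) (q : nat).
Hypothesis q0 : (0 < q)%N.
Implicit Types (u v T : R * R -> 'M[Cplx R]_q).

(** The adjugate stands in for the inverse: it is polynomial in the entries, hence continuous, and
    for a positive determinant it differs from the inverse by a positive factor, which leaves phases
    alone. *)
Lemma adj_intertwine (T u u0 : 'M[Cplx R]_q) : \det T != 0 ->
  u *m T = T *m u0 -> \adj T *m u = u0 *m \adj T.
Proof.
move=> d0 e; apply: (@scalerI _ _ (\det T) d0).
have : \adj T *m (u *m T) *m \adj T = \adj T *m (T *m u0) *m \adj T by rewrite e.
rewrite -!mulmxA mul_mx_adj !mulmxA mul_adj_mx.
by rewrite mul_mx_scalar -mulmxA mul_scalar_mx.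
Qed.

Lemma det_adj_pos (T : 'M[Cplx R]_q) : 0 < \det T -> 0 < \det (\adj T).
Proof.
move=> d0; have := congr1 determinant (mul_mx_adj T).
rewrite det_mulmx det_scalar => e.
by rewrite -(pmulr_rgt0 _ d0) e exprn_gt0.
Qed.

(* The holonomies [Y1] and [Y2] of the flat transport [T] along the two sides
   of the unit square; comparing [T] at the opposite corner along the two
   boundary paths gives the commutation relation. *)
Lemma holonomy_commutator u v (w al1 be1 al2 be2 tau : Cplx R)
    (W1 W2 : 'M[Cplx R]_q) :
  q.-primitive_root w -> continuous u -> continuous v ->
  (forall x, u x ^+ q = 1) -> (forall x, v x ^+ q = 1) ->
  (forall x, u x *m v x = w *: (v x *m u x)) ->
  W1 \in unitmx -> W2 \in unitmx -> W1 *m W2 = tau *: (W2 *m W1) ->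
  (forall x1 x2, W1 *m u (x1 + 1, x2) = al1 *: (u (x1, x2) *m W1)) ->
  (forall x1 x2, W1 *m v (x1 + 1, x2) = be1 *: (v (x1, x2) *m W1)) ->
  (forall x1 x2, W2 *m u (x1, x2) = al2 *: (u (x1, x2 + 1) *m W2)) ->
  (forall x1 x2, W2 *m v (x1, x2) = be2 *: (v (x1, x2 + 1) *m W2)) ->
  exists Y1 Y2 : 'M[Cplx R]_q,
    [/\ Y1 \in unitmx, Y2 \in unitmx,
        Y1 *m u (0, 0) = al1 *: (u (0, 0) *m Y1) /\
        Y1 *m v (0, 0) = be1 *: (v (0, 0) *m Y1),
        Y2 *m u (0, 0) = al2 *: (u (0, 0) *m Y2) /\
        Y2 *m v (0, 0) = be2 *: (v (0, 0) *m Y2) &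
        exists2 c : Cplx R, 0 < c & Y1 *m Y2 = (c * tau) *: (Y2 *m Y1)].
Proof.
move=> wq cu cv u1 v1 uv uW1 uW2 W12 Wu1 Wv1 Wu2 Wv2.
have [T [cT T0 dT TP]] := positive_transport q0 (prim_expr_order wq) cu cv u1 v1 uv.
have dT0 x : \det (T x) != 0 by rewrite gt_eqF.
(* Read from right to left: transport from the origin to one side of the square, identification of
   opposite sides by [W1], transport back to the origin. [Y2] does the same with the other pair of
   sides. *)
pose Y1 t := \adj (T (0, t)) *m W1 *m T (1, t).
pose Y2 t := \adj (T (t, 1)) *m W2 *m T (t, 0).
have box (s t : R) : 0 <= s <= 1 -> 0 <= t <= 1 -> in_box 1 (s, t).
  by rewrite /in_box /= => /andP[s0 s1] /andP[t0 t1]; split; apply/andP; split => //; lra.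
have I0 : 0 <= (0 : R) <= 1 by rewrite lexx ler01.
have I1 : 0 <= (1 : R) <= 1 by rewrite lexx ler01.
have Y1P t : 0 <= t <= 1 -> Y1 t *m u (0, 0) = al1 *: (u (0, 0) *m Y1 t) /\
                            Y1 t *m v (0, 0) = be1 *: (v (0, 0) *m Y1 t).
  move=> tI; have [u' v'] := TP _ (box _ _ I1 tI); have [u'' v''] := TP _ (box _ _ I0 tI).
  have := Wu1 0 t; have := Wv1 0 t; rewrite add0r => ev eu.
  split; rewrite /Y1.
    rewrite -mulmxA -u' mulmxA -(mulmxA _ W1) eu -scalemxAr -scalemxAl.
    by rewrite !mulmxA (adj_intertwine (dT0 _) u'').
  rewrite -mulmxA -v' mulmxA -(mulmxA _ W1) ev -scalemxAr -scalemxAl.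
  by rewrite !mulmxA (adj_intertwine (dT0 _) v'').
have Y2P t : 0 <= t <= 1 -> Y2 t *m u (0, 0) = al2 *: (u (0, 0) *m Y2 t) /\
                            Y2 t *m v (0, 0) = be2 *: (v (0, 0) *m Y2 t).
  move=> tI; have [u' v'] := TP _ (box _ _ tI I0); have [u'' v''] := TP _ (box _ _ tI I1).
  have := Wu2 t 0; have := Wv2 t 0; rewrite add0r => ev eu.
  split; rewrite /Y2.
    rewrite -mulmxA -u' mulmxA -(mulmxA _ W2) eu -scalemxAr -scalemxAl.
    by rewrite !mulmxA (adj_intertwine (dT0 _) u'').
  rewrite -mulmxA -v' mulmxA -(mulmxA _ W2) ev -scalemxAr -scalemxAl.
  by rewrite !mulmxA (adj_intertwine (dT0 _) v'').
have uu x : u x \in unitmx := root1_unitmx q0 (u1 x).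
have uv' x : v x \in unitmx := root1_unitmx q0 (v1 x).
have dW1 : \det W1 != 0 by rewrite -unitfE -unitmxE.
have dW2 : \det W2 != 0 by rewrite -unitfE -unitmxE.
have cadj (g : R -> R * R) : continuous g -> continuous (fun t => \adj (T (g t))).
  move=> cg; exact: (continuous_adj (continuous_compf cg cT)).
have cl (s : R) : continuous (fun t : R => (s, t)).
  exact: (continuous_pairf (@continuous_cstf _ _ s) (@continuous_id R)).
have cr (s : R) : continuous (fun t : R => (t, s)).
  exact: (continuous_pairf (@continuous_id R) (@continuous_cstf _ _ s)).
have cY1 : continuous Y1.
  exact: (continuous_mulmx (continuous_mulmx (cadj _ (cl 0))
    (@continuous_cstmx _ _ _ _ W1)) (continuous_compf (cl 1) cT)).
have cY2 : continuous Y2.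
  exact: (continuous_mulmx (continuous_mulmx (cadj _ (cr 1))
    (@continuous_cstmx _ _ _ _ W2)) (continuous_compf (cr 0) cT)).
have dY1 t : 0 < \det (Y1 t) / \det W1.
  rewrite /Y1 !det_mulmx mulrAC mulfK//; apply: mulr_gt0 => //.
  exact: det_adj_pos.
have dY2 t : 0 < \det (Y2 t) / \det W2.
  rewrite /Y2 !det_mulmx mulrAC mulfK//; apply: mulr_gt0 => //.
  exact: det_adj_pos.
have [l1 l10 Yl1] := positive_holonomy q0 wq (uu _) (uv' _) (uv _) dW1 cY1 Y1P
  (fun t _ => dY1 t).
have [l2 l20 Yl2] := positive_holonomy q0 wq (uu _) (uv' _) (uv _) dW2 cY2 Y2P
  (fun t _ => dY2 t).
have unY (Y : 'M[Cplx R]_q) (k : Cplx R) : 0 < \det Y / k -> Y \in unitmx.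
  by rewrite unitmxE unitfE; apply: contraTneq => ->; rewrite mul0r ltxx.
exists (Y1 0), (Y2 0); split;
  [exact: unY (dY1 0)|exact: unY (dY2 0)|exact: Y1P|exact: Y2P|].
have TY1 t : T (0, t) *m Y1 t = \det (T (0, t)) *: (W1 *m T (1, t)).
  by rewrite /Y1 !mulmxA mul_mx_adj -mulmxA mul_scalar_mx.
have TY2 t : T (t, 1) *m Y2 t = \det (T (t, 1)) *: (W2 *m T (t, 0)).
  by rewrite /Y2 !mulmxA mul_mx_adj -mulmxA mul_scalar_mx.
set d01 := \det (T (0, 1)) in TY1 TY2; set d11 := \det (T (1, 1)).
have d01p : 0 < d01 by exact: dT.
have d11p : 0 < d11 by exact: dT.
(* In [Y1 1 *m Y2 1] the transports at the corner (1, 1) cancel, in [Y2 0 *m Y1 0] those at the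
   origin do. Both leave a product of [W1] and [W2] followed by [T (1, 0)], in opposite orders;
   exchanging them costs [tau]. *)
have eL : T (0, 1) *m (Y1 1 *m Y2 1) = (d01 * d11 * tau) *: (W2 *m W1 *m T (1, 0)).
  rewrite mulmxA TY1 -scalemxAl -(mulmxA W1 (T (1, 1))) TY2 -/d01 -/d11.
  by rewrite -scalemxAr scalerA mulmxA W12 -scalemxAl scalerA.
have eR : T (0, 1) *m (Y2 0 *m Y1 0) = d01 *: (W2 *m W1 *m T (1, 0)).
  rewrite mulmxA TY2 T0 mulmx1 -scalemxAl -/d01 -(mulmxA W2 W1); congr (_ *: (_ *m _)).
  by have := TY1 0; rewrite T0 mul1mx det1 scale1r.
(* [l1] and [l2] are the positive prices of moving the holonomies from t = 1 back to t = 0. *)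
exists (d11 / (l1 * l2)); first by rewrite divr_gt0// mulr_gt0.
have uT : T (0, 1) \in unitmx by rewrite unitmxE unitfE.
apply: (can_inj (mulKmx uT)) => /=.
have l1n : l1 != 0 by rewrite gt_eqF.
have l2n : l2 != 0 by rewrite gt_eqF.
have eY : Y1 1 *m Y2 1 = (l1 * l2) *: (Y1 0 *m Y2 0).
  by rewrite Yl1 Yl2 -scalemxAl -[X in _ *: X]scalemxAr scalerA.
rewrite eY -scalemxAr in eL.
apply: (@scalerI _ _ (l1 * l2)); first by rewrite mulf_neq0.
rewrite eL -scalemxAr eR !scalerA; congr (_ *: _); field.
by rewrite l1n l2n.
Qed.

End Holonomy.

(** * From holonomies to a congruence on winding numbers *)

Section WindingCongruence.
Variables (R : realType) (q : nat).
Hypothesis q0 : (0 < q)%N.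

Lemma zeta_modz (k : int) (n : nat) : n = `|(k %% q)%Z|%N -> zeta R q n = zeta R q k.
Proof.
move=> ->; apply/zeta_eq => //.
have qZ : q%:Z != 0 by case: (q) q0.
rewrite gez0_abs ?modz_ge0//.
by rewrite [X in (_ %| _ - X)%Z](divz_eq k q) opprD addrC addrNK -mulNr dvdz_mull.
Qed.

(** The relations determine [Y1] up to a scalar, and u^m v^n with n = r a and m = - r c modulo q
    solves them explicitly, because w^(r a) = zeta(a). Its commutation with [Y2] is then a count of
    exponents. *)
Lemma twisted_holonomy (p : nat) (r a b c d : int) (u v Y1 Y2 : 'M[Cplx R]_q) :
  coprime p q -> (q %| p%:Z * r - 1)%Z ->
  u \in unitmx -> v \in unitmx -> u *m v = zeta R q p *: (v *m u) ->
  Y1 \in unitmx ->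
  Y1 *m u = zeta R q (- a) *: (u *m Y1) -> Y1 *m v = zeta R q (- c) *: (v *m Y1) ->
  Y2 *m u = zeta R q b *: (u *m Y2) -> Y2 *m v = zeta R q d *: (v *m Y2) ->
  Y2 *m Y1 = zeta R q (r * (a * d - b * c)) *: (Y1 *m Y2).
Proof.
move=> pq pr uu uv uv0 uY1 Y1u Y1v Y2u Y2v.
pose n := `|((r * a) %% q)%Z|%N; pose m := `|((- (r * c)) %% q)%Z|%N.
have zn : zeta R q n = zeta R q (r * a) by exact: zeta_modz.
have zm : zeta R q m = zeta R q (- (r * c)) by exact: zeta_modz.
have zX k (x : nat) (y : int) : zeta R q x = zeta R q y -> zeta R q k ^+ x = zeta R q (k * y).
  move=> /(zeta_eq R _ _ q0) h; rewrite zetaX; apply/zeta_eq => //.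
  by rewrite -mulrBr dvdz_mull.
have wn : zeta R q p ^+ n = zeta R q a.
  rewrite (zX _ _ _ zn); apply/zeta_eq => //.
  have -> : p%:Z * (r * a) - a = (p%:Z * r - 1) * a by ring.
  exact: dvdz_mulr.
have wm : zeta R q p ^+ m = zeta R q (- c).
  rewrite (zX _ _ _ zm); apply/zeta_eq => //.
  have -> : p%:Z * (- (r * c)) - - c = (p%:Z * r - 1) * (- c) by ring.
  exact: dvdz_mulr.
have unX (A : 'M[Cplx R]_q) k : A \in unitmx -> A ^+ k \in unitmx.
  move=> uA; elim: k => [|k IHk]; first by rewrite expr0 unitmx1.
  by rewrite exprS -[_ * _]/(_ *m _) unitmx_mul uA.
pose X := u ^+ m *m v ^+ n.
have uX : X \in unitmx by rewrite unitmx_mul !unX.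
have Xu : X *m u = zeta R q (- a) *: (u *m X).
  have := exp_twistr n uv0; rewrite wn => e.
  apply: (@scalerI _ _ (zeta R q a)); first exact: zeta_neq0.
  rewrite scalerA -zetaD subrr zeta0 scale1r /X -mulmxA scalemxAr -e !mulmxA.
  by congr (_ *m _); exact/esym/(commrX m (commr_refl u)).
have Xv : X *m v = zeta R q (- c) *: (v *m X).
  have e : u ^+ m *m v = zeta R q (- c) *: (v *m u ^+ m).
    by rewrite -wm; exact: (exp_twist m uv0).
  have ev : v ^+ n *m v = v *m v ^+ n by exact/esym/(commrX n (commr_refl v)).
  by rewrite /X -mulmxA ev !mulmxA e -scalemxAl.
have [k kE] : exists k, invmx X *m Y1 = k%:M.
  by apply: (twisted_commutant (expi_prim_root R q0 pq) uu uv uv0);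
    [exact: (twisted_ratio_comm uX Xu Y1u)|exact: (twisted_ratio_comm uX Xv Y1v)].
have Y1E : Y1 = k *: X.
  by rewrite -(mulKVmx uX Y1) kE mul_mx_scalar.
have Y2X : Y2 *m X = zeta R q (r * (a * d - b * c)) *: (X *m Y2).
  rewrite /X mulmxA (exp_twistr m Y2u) (zX _ _ _ zm) -scalemxAl -(mulmxA _ Y2).
  rewrite (exp_twistr n Y2v) (zX _ _ _ zn) -scalemxAr scalerA -zetaD mulmxA.
  by congr (zeta _ _ _ *: _); ring.
by rewrite Y1E -scalemxAr Y2X -scalemxAl !scalerA mulrC.
Qed.

Lemma exp_scalemx (F : comNzRingType) n (c : F) (A : 'M[F]_n) k :
  (c *: A) ^+ k = c ^+ k *: A ^+ k.
Proof.
elim: k => [|k IHk]; first by rewrite !expr0 scale1r.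
rewrite !exprS IHk.
rewrite -[LHS]/((c *: A) *m (c ^+ k *: A ^+ k)) -[A * _]/(A *m _).
by rewrite -scalemxAl -[X in _ *: X]scalemxAr scalerA.
Qed.

Lemma normalize_power (f : R) (A : 'M[Cplx R]_q) :
  A ^+ q = (expi f)%:M -> (expi (- f / q%:R) *: A) ^+ q = 1.
Proof.
move=> Aq; have e : expi (- f / q%:R) ^+ q = expi (- f).
  by rewrite expiX; congr expi; rewrite mulrC divfK// pnatr_eq0 -lt0n.
have e1 : expi (- f) * expi f = 1 by rewrite -expiD addNr expi0.
rewrite exp_scalemx Aq e scale_scalar_mx e1; exact: erefl.
Qed.

(** The cost of normalising: each unit translation multiplies the normalised matrix by a root of
    unity that records the winding number. *)
Lemma normalize_shift (f : R) (n : int) :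
  expi (- (f + n%:~R) / q%:R) = zeta R q (- n) * expi (- f / q%:R).
Proof. by rewrite /zeta -expiD -mulrDl intrN opprD addrC. Qed.

Lemma winding_congruence (p p' r r' : nat) (u v : matfun R q) (F G : R * R -> R)
    (a b c d : int) :
  coprime p q -> (q %| p%:Z * r%:Z - 1)%Z -> (q %| p'%:Z * r'%:Z - 1)%Z ->
  quasi_periodic (V0 R p' q ^+ r') (U0 R q ^+ r') u ->
  quasi_periodic (V0 R p' q ^+ r') (U0 R q ^+ r') v ->
  (forall x, u x *m v x = zeta R q p *: (v x *m u x)) ->
  (forall x, u x ^+ q = (expi (F x))%:M) -> (forall x, v x ^+ q = (expi (G x))%:M) ->
  continuous F -> continuous G ->
  (forall x1 x2, F (x1 + 1, x2) = F (x1, x2) + a%:~R /\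
                 F (x1, x2 + 1) = F (x1, x2) + b%:~R) ->
  (forall x1 x2, G (x1 + 1, x2) = G (x1, x2) + c%:~R /\
                 G (x1, x2 + 1) = G (x1, x2) + d%:~R) ->
  (q %| r%:Z * (a * d - b * c) - r'%:Z)%Z.
Proof.
move=> pq pr pr' [[cu _] Pu] [[cv _] Pv] uv uq vq cF cG hF hG.
set W1 := V0 R p' q ^+ r' in Pu Pv; set W2 := U0 R q ^+ r' in Pu Pv.
pose nu x := expi (- F x / q%:R) *: u x.
pose nv x := expi (- G x / q%:R) *: v x.
have cn (H : R * R -> R) : continuous H -> continuous (fun x => expi (- H x / q%:R)).
  move=> cH; apply: continuous_expi; apply: continuous_mulf.
    exact: continuous_oppf.
  exact: continuous_cstf.
have uW1 : W1 \in unitmx.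
  by have [] := mulmx1_unit (unitary_exp r' (V0_unitary R q p')).
have uW2 : W2 \in unitmx.
  by have [] := mulmx1_unit (unitary_exp r' (U0_unitary R q0)).
have W12 : W1 *m W2 = zeta R q (- r'%:Z) *: (W2 *m W1).
  have e : W2 *m V0 R p' q = zeta R q 1 *: (V0 R p' q *m W2).
    by rewrite -(zeta_pr R q0 pr'); exact: (exp_twist r' (U0V0 R p' q0)).
  have := exp_twistr r' e; rewrite zetaX mul1r -/W1 => ->.
  by rewrite scalerA -zetaD addNr zeta0 scale1r.
have sh1 (H : R * R -> R) (A : matfun R q) (k : int) x1 x2 :
    H (x1 + 1, x2) = H (x1, x2) + k%:~R ->
    W1 *m A (x1 + 1, x2) = A (x1, x2) *m W1 ->
    W1 *m (expi (- H (x1 + 1, x2) / q%:R) *: A (x1 + 1, x2)) =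
    zeta R q (- k) *: ((expi (- H (x1, x2) / q%:R) *: A (x1, x2)) *m W1).
  move=> -> e; rewrite normalize_shift -[LHS]scalemxAr e -[in RHS]scalemxAl.
  by rewrite scalerA.
have sh2 (H : R * R -> R) (A : matfun R q) (k : int) x1 x2 :
    H (x1, x2 + 1) = H (x1, x2) + k%:~R ->
    W2 *m A (x1, x2) = A (x1, x2 + 1) *m W2 ->
    W2 *m (expi (- H (x1, x2) / q%:R) *: A (x1, x2)) =
    zeta R q k *: ((expi (- H (x1, x2 + 1) / q%:R) *: A (x1, x2 + 1)) *m W2).
  move=> -> e; rewrite normalize_shift -[LHS]scalemxAr e -[in RHS]scalemxAl.
  rewrite scalerA; congr (_ *: _).
  by rewrite zetaN mulVKf// zeta_neq0.
have nuq x : nu x ^+ q = 1 by exact: normalize_power.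
have nvq x : nv x ^+ q = 1 by exact: normalize_power.
have nuv x : nu x *m nv x = zeta R q p *: (nv x *m nu x) by exact: scale_twist.
have cnu : continuous nu by exact: (continuous_scalemx (cn _ cF) cu).
have cnv : continuous nv by exact: (continuous_scalemx (cn _ cG) cv).
have s1u x1 x2 := sh1 F u a x1 x2 (hF x1 x2).1 (Pu x1 x2).1.
have s1v x1 x2 := sh1 G v c x1 x2 (hG x1 x2).1 (Pv x1 x2).1.
have s2u x1 x2 := sh2 F u b x1 x2 (hF x1 x2).2 (Pu x1 x2).2.
have s2v x1 x2 := sh2 G v d x1 x2 (hG x1 x2).2 (Pv x1 x2).2.
have wq := expi_prim_root R q0 pq.
have [Y1 [Y2 [uY1 uY2 [Y1u Y1v] [Y2u Y2v] [l l0 Y12]]]] :=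
  holonomy_commutator q0 wq cnu cnv nuq nvq nuv uW1 uW2 W12 s1u s1v s2u s2v.
(* A second commutation rule for the same two holonomies; substituting one rule into the other
   leaves an identity between scalars. *)
have := twisted_holonomy pq pr (root1_unitmx q0 (nuq (0, 0)))
  (root1_unitmx q0 (nvq (0, 0))) (nuv (0, 0)) uY1 Y1u Y1v Y2u Y2v.
rewrite Y12 scalerA => e.
have uY : Y2 *m Y1 \in unitmx by rewrite unitmx_mul uY2.
have {e} e1 : zeta R q (r%:Z * (a * d - b * c)) * (l * zeta R q (- r'%:Z)) = 1.
  have := congr1 (fun A => A *m invmx (Y2 *m Y1)) e.
  rewrite -scalemxAl mulmxV// => /matrixP/(_ (Ordinal q0) (Ordinal q0)).
  by rewrite !mxE eqxx mulr1n mulr1.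
(* Roots of unity have modulus one, so taking norms isolates the positive factor. *)
have l1 : l = 1.
  have := congr1 Num.norm e1; rewrite !normrM !norm_zeta normr1 mul1r mulr1.
  by rewrite gtr0_norm.
by move: e1; rewrite l1 mul1r -zetaD => /(zeta_eq1 R _ q0).
Qed.

End WindingCongruence.

(** * Central elements *)

Section ScalarElements.
Variables (R : realType) (p q : nat).
Hypothesis q0 : (0 < q)%N.

Lemma periodic_int (f : R * R -> R) :
  (forall x1 x2, f (x1 + q%:R, x2) = f (x1, x2) /\ f (x1, x2 + q%:R) = f (x1, x2)) ->
  forall (m n : int) x1 x2, f (x1 + m%:~R * q%:R, x2 + n%:~R * q%:R) = f (x1, x2).
Proof.
move=> fp.
have pos1 (k : nat) x1 x2 : f (x1 + k%:R * q%:R, x2) = f (x1, x2).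
  elim: k => [|k IHk]; first by rewrite mul0r addr0.
  by rewrite -natr1 mulrDl mul1r addrA (fp _ x2).1.
have pos2 (k : nat) x1 x2 : f (x1, x2 + k%:R * q%:R) = f (x1, x2).
  elim: k => [|k IHk]; first by rewrite mul0r addr0.
  by rewrite -natr1 mulrDl mul1r addrA (fp x1 _).2.
move=> m n x1 x2.
transitivity (f (x1, x2 + n%:~R * q%:R)).
  case: m => m; first exact: pos1.
  by rewrite NegzE intrN -(pos1 m.+1) mulNr subrK.
case: n => n; first exact: pos2.
by rewrite NegzE intrN -(pos2 n.+1) mulNr subrK.
Qed.

Lemma periodic_bounds (f : R * R -> R) : continuous f ->
  (forall x1 x2, f (x1 + q%:R, x2) = f (x1, x2) /\ f (x1, x2 + q%:R) = f (x1, x2)) ->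
  (forall x, 0 < f x) ->
  exists d C : R, [/\ 0 < d, 0 < C & forall x, d <= f x <= C].
Proof.
move=> cf fp f0.
have qR : 0 < q%:R :> R by rewrite ltr0n.
pose K := (`[0, q%:R] `*` `[0, q%:R]) : set (R * R).
have cK : compact K by apply: compact_setX; exact: segment_compact.
have K0 : K !=set0 by exists (0, 0); split; rewrite /= in_itv /= lexx ltW.
have [c _ cm] := compact_EVT_min K0 cK (continuous_subspaceT cf).
have [C _ CM] := compact_EVT_max K0 cK (continuous_subspaceT cf).
exists (f c), (f C); split => // x.
have red (t : R) : exists2 s : R, s \in `[0, q%:R] &
    exists n : int, t = s + n%:~R * q%:R.
  pose n := Num.floor (t / q%:R).
  exists (t - n%:~R * q%:R); last by exists n; rewrite subrK.
  have h1 : n%:~R * q%:R <= t by rewrite -ler_pdivlMr// Num.Theory.floor_le_tmp.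
  have h2 : t < (n + 1)%:~R * q%:R.
    by rewrite -ltr_pdivrMr// Num.Theory.floorD1_gt.
  rewrite intrD mulrDl mul1r in h2.
  by rewrite in_itv /=; apply/andP; split; lra.
have [s1 s1I [m mE]] := red x.1; have [s2 s2I [n nE]] := red x.2.
have -> : f x = f (s1, s2) by rewrite -(periodic_int fp m n) -mE -nE; case: (x).
have Ks : (s1, s2) \in K by apply: mem_set; split.
by rewrite cm// CM.
Qed.

(** With d <= f <= C, the geometric series for 1/f in powers of 1 - f/C converges uniformly, and its
    partial sums are polynomials in f, so closedness of the algebra applies. *)
Lemma rotation_scalar_inverse (f : R * R -> R) :
  continuous f -> (forall x, 0 < f x) ->
  rotation_alg R p q (fun x => (f x)%:C%:M) ->
  rotation_alg R p q (fun x => (f x)^-1%:C%:M).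
Proof.
move=> cf f0 Af; have CA := @rotation_Cstar R p q q0.
pose i0 : 'I_q := Ordinal q0.
have fp x1 x2 : f (x1 + q%:R, x2) = f (x1, x2) /\ f (x1, x2 + q%:R) = f (x1, x2).
  have [_ /(_ x1 x2)[/matrixP/(_ i0 i0) + /matrixP/(_ i0 i0)]] := Cstar_sub CA Af.
  by rewrite !mxE eqxx !mulr1n => /complexI -> /complexI ->.
have [d [C [d0 C0 dC]]] := periodic_bounds cf fp f0.
have C1 : C != 0 by rewrite gt_eqF.
(* Closed form of the partial sum of (1 - f/C)^k / C over k < n. *)
pose s (n : nat) x := (1 - (1 - f x / C) ^+ n) / f x.
have As n : rotation_alg R p q (fun x => (s n x)%:C%:M).
  elim: n => [|n IHn].
    rewrite (_ : (fun x => _) = 0); first exact: (Cstar_zero CA).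
    by apply/funext => x; rewrite /s expr0 subrr mul0r; apply/matrixP => i j;
       rewrite !mxE mul0rn.
  rewrite (_ : (fun x => _) = (C^-1%:C : Cplx R) *: (fun=> 1%:M) +
     mfmul ((fun=> 1%:M) - (C^-1%:C : Cplx R) *: (fun x => (f x)%:C%:M))
       (fun x => (s n x)%:C%:M)).
    apply: (Cstar_add CA).
      by apply: (Cstar_scale CA); exact: rotation_1.
    apply: (Cstar_mul CA) => //; apply: (Cstar_sub2 CA); first exact: rotation_1.
    by apply: (Cstar_scale CA).
  apply/funext => x; rewrite /mfmul !fctE.
  have -> : s n.+1 x = C^-1 + (1 - C^-1 * f x) * s n x.
    by rewrite /s exprS; field; rewrite C1 gt_eqF.
  rewrite scalemx1 scale_scalar_mx -raddfB -scalar_mxM -raddfD.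
  by rewrite (rmorphD (real_complex R)) rmorphM rmorphB rmorphM rmorph1.
have [cfC pf] := Cstar_sub CA Af.
apply: (Cstar_uniform_closed CA) => [|e e0].
  split; last by move=> x1 x2; have [-> ->] := fp x1 x2.
  apply: continuous_scalar_mx; apply: continuous_real_complex => x.
  by apply: cvgV; [rewrite gt_eqF|exact: cf].
pose rho := 1 - d / C.
have dleC : d <= C by have /andP[] := dC (0, 0); exact: le_trans.
have rho0 : 0 <= rho by rewrite subr_ge0 ler_pdivrMr// mul1r.
have rho1 : `|rho| < 1 by rewrite ger0_norm// gtrBl divr_gt0.
have [n rhon] : exists n, rho ^+ n < e * d.
  have := cvg_expr rho1.
  move=> /cvgrPdist_lt/(_ (e * d) (mulr_gt0 e0 d0))[n _ /(_ n (leqnn n))] /=.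
  by rewrite sub0r normrN ger0_norm ?exprn_ge0//; exists n.
exists (fun x => (s n x)%:C%:M); first exact: As.
move=> x i j; rewrite !mxE -mulrnBl -rmorphB.
have /andP[df fC] := dC x.
have b0 : 0 <= 1 - f x / C by rewrite subr_ge0 ler_pdivrMr// mul1r.
have -> : (f x)^-1 - s n x = (1 - f x / C) ^+ n / f x.
  by rewrite /s; field; rewrite gt_eqF.
have bn : (1 - f x / C) ^+ n / f x <= e.
  rewrite ler_pdivrMr//; apply: (@le_trans _ _ (rho ^+ n)).
    rewrite lerXn2r ?nnegrE// lerD2l lerN2 ler_pM2r ?invr_gt0//.
  by apply: (le_trans (ltW rhon)); rewrite ler_pM2l.
case: (i == j); last by rewrite mulr0n normr0 ler0c ltW.
rewrite mulr1n normc_def /= expr0n addr0 sqrtr_sqr lecR ger0_norm//.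
by rewrite divr_ge0 ?exprn_ge0// ltW.
Qed.

End ScalarElements.

(** * Winding numbers and central unitaries *)

Lemma winding_exists (R : realType) (F : R * R -> R) : continuous F ->
  (forall x1 x2, expi (F (x1 + 1, x2)) = expi (F (x1, x2)) /\
                 expi (F (x1, x2 + 1)) = expi (F (x1, x2))) ->
  exists a b : int, forall x1 x2,
    F (x1 + 1, x2) = F (x1, x2) + a%:~R /\ F (x1, x2 + 1) = F (x1, x2) + b%:~R.
Proof.
move=> cF Fp.
have shift (e1 e2 : R) : (forall x1 x2, expi (F (x1 + e1, x2 + e2)) = expi (F (x1, x2))) ->
    exists a : int, forall x1 x2, F (x1 + e1, x2 + e2) = F (x1, x2) + a%:~R.
  move=> Fe; pose h x := F (x.1 + e1, x.2 + e2) - F x.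
  have hZ x : exists n : int, h x = n%:~R.
    have [n nE] := expi_inj (Fe x.1 x.2); exists n.
    by rewrite /h nE; case: (x) => ? ? /=; rewrite addrAC subrr add0r.
  have ch : continuous h.
    apply: continuous_addf; last exact: continuous_oppf.
    apply: continuous_compf cF; apply: continuous_pairf; apply: continuous_addf;
      (try exact: continuous_cstf); [exact: continuous_fst|exact: continuous_snd].
  have [a aE] := hZ (0, 0); exists a => x1 x2.
  have : h (x1, x2) = h (0, 0) by apply: int_valued_const => // t _; exact: hZ.
  by rewrite aE => <-; rewrite /h /= [RHS]addrC subrK.
have [a aE] : exists a : int, forall x1 x2, F (x1 + 1, x2 + 0) = F (x1, x2) + a%:~R.
  by apply: shift => x1 x2; rewrite addr0; case: (Fp x1 x2).
have [b bE] : exists b : int, forall x1 x2, F (x1 + 0, x2 + 1) = F (x1, x2) + b%:~R.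
  by apply: shift => x1 x2; rewrite addr0; case: (Fp x1 x2).
exists a, b => x1 x2; split.
  by have := aE x1 x2; rewrite addr0.
by have := bE x1 x2; rewrite addr0.
Qed.

Lemma winding_int (R : realType) (F : R * R -> R) (a b : int) :
  (forall x1 x2,
    F (x1 + 1, x2) = F (x1, x2) + a%:~R /\ F (x1, x2 + 1) = F (x1, x2) + b%:~R) ->
  forall (m n : int) x1 x2,
    F (x1 + m%:~R, x2 + n%:~R) = F (x1, x2) + (m * a + n * b)%:~R.
Proof.
move=> Fw.
have pos1 (k : nat) x1 x2 : F (x1 + k%:R, x2) = F (x1, x2) + (k%:Z * a)%:~R.
  elim: k => [|k IHk]; first by rewrite !addr0 mul0r addr0.
  by rewrite -natr1 addrA (Fw _ x2).1 IHk -addrA -intrD; congr (_ + _%:~R); ring.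
have pos2 (k : nat) x1 x2 : F (x1, x2 + k%:R) = F (x1, x2) + (k%:Z * b)%:~R.
  elim: k => [|k IHk]; first by rewrite !addr0 mul0r addr0.
  by rewrite -natr1 addrA (Fw x1 _).2 IHk -addrA -intrD; congr (_ + _%:~R); ring.
have int1 (m : int) x1 x2 : F (x1 + m%:~R, x2) = F (x1, x2) + (m * a)%:~R.
  case: m => m; first exact: pos1.
  have := pos1 m.+1 (x1 - m.+1%:R) x2; rewrite subrK NegzE intrN => ->.
  by rewrite -addrA -intrD mulNr subrr addr0.
have int2 (m : int) x1 x2 : F (x1, x2 + m%:~R) = F (x1, x2) + (m * b)%:~R.
  case: m => m; first exact: pos2.
  have := pos2 m.+1 x1 (x2 - m.+1%:R); rewrite subrK NegzE intrN => ->.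
  by rewrite -addrA -intrD mulNr subrr addr0.
by move=> m n x1 x2; rewrite int1 int2 -addrA -intrD [X in X%:~R]addrC.
Qed.

Section Powers.
Variables (R : realType) (p q : nat).
Hypothesis q0 : (0 < q)%N.

Lemma unitary_power (a : matfun R q) k :
  mfmul a (mfstar a) = (fun=> 1%:M) ->
  mfmul (fun x => a x ^+ k) (mfstar (fun x => a x ^+ k)) = (fun=> 1%:M).
Proof.
move=> a1; apply/funext => x; apply: unitary_exp.
exact: (congr1 (fun b : matfun R q => b x) a1).
Qed.

Lemma rotation_exp (a : matfun R q) k : rotation_alg R p q a ->
  rotation_alg R p q (fun x => a x ^+ k).
Proof.
move=> Aa; elim: k => [|k IHk].
  rewrite (_ : (fun x => _) = fun=> 1%:M); first exact: rotation_1.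
  by apply/funext => x; rewrite expr0.
rewrite (_ : (fun x => _) = mfmul a (fun x => a x ^+ k)).
  exact: (Cstar_mul (rotation_Cstar _ _ _)).
by apply/funext => x; rewrite exprS.
Qed.

Lemma Ufun_exp (x : R * R) : @Ufun R q x ^+ q = (expi x.1)%:M.
Proof.
rewrite UfunE exp_scalemx U0q// expiX mulrC divfK ?pnatr_eq0 -?lt0n//.
exact: scalemx1.
Qed.

Lemma Vfun_exp (x : R * R) : @Vfun R p q x ^+ q = (expi x.2)%:M.
Proof.
rewrite VfunE exp_scalemx V0q// expiX mulrC divfK ?pnatr_eq0 -?lt0n//.
exact: scalemx1.
Qed.

End Powers.

Section CentralUnitaries.
Variables (R : realType) (p q r : nat).
Hypothesis q0 : (0 < q)%N.
Hypothesis pr : (q %| p%:Z * r%:Z - 1)%Z.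

(** Conjugation is trivial on scalars, so a scalar quasi-periodic element is periodic under unit
    translations, and a continuous logarithm of it changes by integers. *)
Lemma central_unitary_lift (a : matfun R q) :
  rotation_alg R p q a -> mfmul a (mfstar a) = (fun=> 1%:M) ->
  (forall x, exists c, a x = c%:M) ->
  exists F : R * R -> R, exists m n : int,
    [/\ continuous F, forall x, a x = (expi (F x))%:M &
        forall x1 x2, F (x1 + 1, x2) = F (x1, x2) + m%:~R /\
                      F (x1, x2 + 1) = F (x1, x2) + n%:~R].
Proof.
move=> Aa a1 ac; pose i0 : 'I_q := Ordinal q0; pose f x := a x i0 i0.
have aE x : a x = (f x)%:M.
  by have [c cE] := ac x; rewrite /f cE mxE eqxx mulr1n.
have [[/continuous_mxP/(_ i0 i0) cf _] qp] := rotation_quasi_periodic q0 pr Aa.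
have f1 x : `|f x| = 1.
  have := congr1 (fun b : matfun R q => b x i0 i0) a1.
  rewrite /mfmul /mfstar -/(mxstar _) aE mxstar_scalar -scalar_mxM !mxE eqxx !mulr1n.
  rewrite -normCK => /eqP; rewrite -[X in _ == X](expr1n _ 2).
  by rewrite eqrXn2// => /eqP.
have [F cF FE] := lift_exists cf f1.
have inj (W : 'M[Cplx R]_q) (c d : Cplx R) : W *m mxstar W = 1%:M ->
    W *m c%:M = d%:M *m W -> c = d.
  move=> W1 /(congr1 (fun A => A *m mxstar W)).
  rewrite mul_mx_scalar mul_scalar_mx -!scalemxAl W1 !scalemx1.
  by move=> /matrixP/(_ i0 i0); rewrite !mxE eqxx !mulr1n.
have uV := unitary_exp r (V0_unitary R q p).
have uU := unitary_exp r (U0_unitary R q0).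
have [m [n Fmn]] : exists m n : int, forall x1 x2,
    F (x1 + 1, x2) = F (x1, x2) + m%:~R /\ F (x1, x2 + 1) = F (x1, x2) + n%:~R.
  apply: winding_exists => // x1 x2; have [h1 h2] := qp x1 x2.
  rewrite !aE in h1 h2; rewrite !FE.
  by split; [exact: (inj _ _ _ uV h1)|exact/esym/(inj _ _ _ uU h2)].
by exists F, m, n; split => // x; rewrite FE -aE.
Qed.

End CentralUnitaries.

(** * Algebraic consequences of an isomorphism *)

Section Isomorphism.
Variables (R : realType) (p q p' q' : nat).
Hypotheses (q0 : (0 < q)%N) (q0' : (0 < q')%N).
Hypotheses (pq : coprime p q) (pq' : coprime p' q').
Let A := rotation_alg R p q.
Let A' := rotation_alg R p' q'.
Variable phi : matfun R q -> matfun R q'.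
Hypothesis phi_fun : forall a, A a -> A' (phi a).
Hypothesis phi_inj : forall a b, A a -> A b -> phi a = phi b -> a = b.
Hypothesis phi_surj : forall b, A' b -> exists2 a, A a & phi a = b.
Hypothesis phiD : forall a b, A a -> A b -> phi (a + b) = phi a + phi b.
Hypothesis phiZ : forall (c : Cplx R) a, A a -> phi (c *: a) = c *: phi a.
Hypothesis phiM : forall a b, A a -> A b -> phi (mfmul a b) = mfmul (phi a) (phi b).
Hypothesis phiS : forall a, A a -> phi (mfstar a) = mfstar (phi a).
Let CA := @rotation_Cstar R p q q0.
Let CA' := @rotation_Cstar R p' q' q0'.
Let one n : matfun R n := fun=> 1%:M.
Let A1 : A (one q) := @rotation_1 R p q q0.
Let A'1 : A' (one q') := @rotation_1 R p' q' q0'.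
Let AU := @rotation_U R p q.
Let AV := @rotation_V R p q.

Lemma mfmul1 n (a : matfun R n) : mfmul (one n) a = a.
Proof. by apply/funext => x; rewrite /mfmul mul1mx. Qed.

Lemma mfmulr1 n (a : matfun R n) : mfmul a (one n) = a.
Proof. by apply/funext => x; rewrite /mfmul mulmx1. Qed.

Lemma iso_one : phi (one q) = one q'.
Proof.
have [a Aa aE] := phi_surj A'1.
by rewrite -[LHS]mfmulr1 -aE -phiM// mfmul1.
Qed.

Lemma iso_exp a k : A a -> phi (fun x => a x ^+ k) = fun x => phi a x ^+ k.
Proof.
move=> Aa; have e0 n (b : matfun R n) : (fun x => b x ^+ 0) = one n.
  by apply/funext => x; rewrite expr0.
have e n (b : matfun R n) j : (fun x => b x ^+ j.+1) = mfmul b (fun x => b x ^+ j).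
  by apply/funext => x; rewrite exprS.
elim: k => [|k IHk]; first by rewrite !e0 iso_one.
by rewrite !e phiM ?IHk//; exact: rotation_exp.
Qed.

Lemma iso_unitary a : A a -> mfmul a (mfstar a) = one q ->
  mfmul (phi a) (mfstar (phi a)) = one q'.
Proof.
by move=> Aa a1; rewrite -phiS// -phiM ?a1 ?iso_one//; exact: (Cstar_star CA).
Qed.

Lemma iso_unitary_inv a : A a -> mfmul (phi a) (mfstar (phi a)) = one q' ->
  mfmul a (mfstar a) = one q.
Proof.
move=> Aa a1; have As : A (mfstar a) by exact: (Cstar_star CA).
by apply: phi_inj; [exact: (Cstar_mul CA)|exact: A1|rewrite phiM// phiS// a1 iso_one].
Qed.

Lemma unitary_unit n (a : matfun R n) x : mfmul a (mfstar a) = one n -> a x \in unitmx.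
Proof. by move=> /(congr1 (fun b : matfun R _ => b x)) e; have [] := mulmx1_unit e. Qed.

Let u := phi (@Ufun R q).
Let v := phi (@Vfun R p q).

Lemma iso_twist x : u x *m v x = zeta R q p *: (v x *m u x).
Proof.
have : phi (mfmul (@Ufun R q) (@Vfun R p q)) =
       phi (zeta R q p *: mfmul (@Vfun R p q) (@Ufun R q)).
  by congr phi; apply/funext => y; rewrite /mfmul UV_twist.
rewrite phiM// phiZ ?phiM//; last exact: (Cstar_mul CA).
by move=> /(congr1 (fun b : matfun R _ => b x)).
Qed.

Lemma iso_u_unit x : u x \in unitmx.
Proof. by apply/unitary_unit/iso_unitary => //; exact: Ufun_unitary. Qed.

Lemma iso_v_unit x : v x \in unitmx.
Proof. by apply/unitary_unit/iso_unitary => //; exact: Vfun_unitary. Qed.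

Lemma iso_dvd : (q %| q')%N.
Proof.
rewrite (prim_order_dvd (expi_prim_root R q0 pq)).
by apply/eqP; apply: (twisted_dim (iso_u_unit (0, 0)) (iso_v_unit (0, 0)));
  exact: iso_twist.
Qed.

Lemma iso_dvd' : (q' %| q)%N.
Proof.
have [a Aa aE] := phi_surj (@rotation_U R p' q').
have [b Ab bE] := phi_surj (@rotation_V R p' q').
have ua : a (0, 0) \in unitmx.
  by apply/unitary_unit/iso_unitary_inv => //; rewrite aE Ufun_unitary.
have ub : b (0, 0) \in unitmx.
  by apply/unitary_unit/iso_unitary_inv => //; rewrite bE Vfun_unitary.
have e : mfmul a b = zeta R q' p' *: mfmul b a.
  have Aba : A (mfmul b a) by exact: (Cstar_mul CA).
  apply: phi_inj; [exact: (Cstar_mul CA)|exact: (Cstar_scale CA)|].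
  rewrite phiZ// !phiM// aE bE; apply/funext => y.
  by rewrite /mfmul UV_twist.
rewrite (prim_order_dvd (expi_prim_root R q0' pq')); apply/eqP.
by apply: (twisted_dim ua ub); exact: (congr1 (fun c : matfun R q => c (0, 0)) e).
Qed.

(* A point [y] of the torus of the target gives a character of the centre of
   the source, which is evaluation at the point [(F y, G y)]: otherwise the sum
   of squares below would be invertible in the source but killed by the
   character. *)
Lemma iso_evaluation (F G H : R * R -> R) (a : matfun R q) (H' : R * R -> R)
    (m n : int) :
  (forall x, u x ^+ q = (expi (F x))%:M) -> (forall x, v x ^+ q = (expi (G x))%:M) ->
  A a -> continuous H -> (forall x, a x = (expi (H x))%:M) ->
  (forall x1 x2, H (x1 + 1, x2) = H (x1, x2) + m%:~R /\
                 H (x1, x2 + 1) = H (x1, x2) + n%:~R) ->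
  (forall y, phi a y = (expi (H' y))%:M) ->
  forall y, expi (H (F y, G y)) = expi (H' y).
Proof.
move=> uq vq Aa cH aE Hw phia y; apply/eqP/negPn/negP => neq.
have AUq := rotation_exp q0 q AU; have phiUq := @iso_exp _ q AU.
have AVq := rotation_exp q0 q AV; have phiVq := @iso_exp _ q AV.
(* [nsq c b] is (b - c)(b - c)^*; if [phi b y] is the scalar [c], its image under [phi] vanishes at
   [y]. *)
pose nsq c b : matfun R q := mfmul (b - (c : Cplx R) *: one q) (mfstar (b - c *: one q)).
have Ansq c b : A b -> A (nsq c b).
  move=> Ab; have Abc : A (b - c *: one q).
    by apply: (Cstar_sub2 CA) => //; exact: (Cstar_scale CA).
  by apply: (Cstar_mul CA) => //; exact: (Cstar_star CA).
have phi_nsq c b : A b -> phi b y = c%:M -> phi (nsq c b) y = 0.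
  move=> Ab bc; have Ac : A (c *: one q) by exact: (Cstar_scale CA).
  have An : A (- (c *: one q)) by exact: (Cstar_opp CA Ac).
  have Abc : A (b - c *: one q) by exact: (Cstar_add CA).
  rewrite phiM//; last exact: (Cstar_star CA).
  rewrite /mfmul [X in X *m _](_ : _ = 0) ?mul0mx//.
  rewrite phiD// -scaleN1r phiZ// phiZ// iso_one !fctE bc.
  by rewrite scalemx1 scaleN1r subrr.
have phi_sum3 b1 b2 b3 : A b1 -> A b2 -> A b3 ->
    phi b1 y = 0 -> phi b2 y = 0 -> phi b3 y = 0 -> phi (b1 + b2 + b3) y = 0.
  move=> Ab1 Ab2 Ab3 e1 e2 e3; rewrite phiD ?phiD//; last exact: (Cstar_add CA).
  by rewrite !fctE e1 e2 e3 !addr0.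
have nsqE c b x t : b x = (expi t)%:M -> nsq c b x = (`|expi t - c| ^+ 2)%:M.
  move=> bx; rewrite /nsq /mfmul /mfstar -/(mxstar _) !fctE bx scalemx1.
  by rewrite -raddfB mxstar_scalar -scalar_mxM normCK.
pose sq (z : Cplx R) : R := complex.Re z ^+ 2 + complex.Im z ^+ 2.
have sqE z : (sq z)%:C = `|z| ^+ 2 by exact: add_Re2_Im2.
have sq0 z : 0 <= sq z by rewrite addr_ge0 ?sqr_ge0.
have sq_eq0 z : sq z = 0 -> z = 0.
  by move=> z0; apply/eqP; rewrite -normr_eq0 -sqrf_eq0 -sqE z0.
pose be x : R := sq (expi (H x) - expi (H' y)) + sq (expi x.1 - expi (F y)) +
  sq (expi x.2 - expi (G y)).
pose b := nsq (expi (H' y)) a + nsq (expi (F y)) (fun x => @Ufun R q x ^+ q) +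
          nsq (expi (G y)) (fun x => @Vfun R p q x ^+ q).
have bE : b = fun x => (be x)%:C%:M.
  apply/funext => x; rewrite /b !fctE (nsqE _ _ _ _ (aE x)) (nsqE _ _ _ _ (Ufun_exp q0 x)).
  rewrite (nsqE _ _ _ _ (Vfun_exp p q0 x)) -!raddfD -!sqE; congr (_%:M).
  by rewrite /be !rmorphD.
have csq (f : R * R -> Cplx R) : continuous f -> continuous (fun x => sq (f x)).
  move=> cf; apply: continuous_addf; apply: continuous_exprf.
    exact: continuous_Ref.
  exact: continuous_Imf.
have cexp (f : R * R -> R) (c : Cplx R) : continuous f ->
    continuous (fun x => expi (f x) - c).
  move=> cf; apply: continuous_addf; last exact: continuous_cstf.
  exact: continuous_expi.
have cbe : continuous be.
  apply: continuous_addf; first apply: continuous_addf.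
  - by apply: csq; exact: cexp.
  - by apply: csq; apply: cexp; exact: continuous_fst.
  - by apply: csq; apply: cexp; exact: continuous_snd.
(* A zero [x] of [be] would differ from [(F y, G y)] by integers, so [expi (H x)] would equal
   [expi (H (F y, G y))], which is not [expi (H' y)]. *)
have be0 x : 0 < be x.
  have be_ge0 : 0 <= be x := addr_ge0 (addr_ge0 (sq0 _) (sq0 _)) (sq0 _).
  rewrite lt_def be_ge0 andbT; apply/negP => /eqP be0.
  have [h1 [h2 h3]] : sq (expi (H x) - expi (H' y)) = 0 /\
      sq (expi x.1 - expi (F y)) = 0 /\ sq (expi x.2 - expi (G y)) = 0.
    have := sq0 (expi (H x) - expi (H' y)); have := sq0 (expi x.1 - expi (F y)).
    by have := sq0 (expi x.2 - expi (G y)); move: be0; rewrite /be => ? ? ? ?; lra.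
  have /eqP := sq_eq0 _ h2; rewrite subr_eq0 => /eqP/expi_inj[k kE].
  have /eqP := sq_eq0 _ h3; rewrite subr_eq0 => /eqP/expi_inj[l lE].
  have := sq_eq0 _ h1; case: x kE lE {h1 h2 h3 be0 be_ge0} => x1 x2 /= -> ->.
  rewrite (winding_int Hw) expiD expi_int mulr1 => /eqP.
  by rewrite subr_eq0 (negbTE neq).
have A1' := Ansq (expi (H' y)) _ Aa.
have A2' := Ansq (expi (F y)) _ AUq.
have A3' := Ansq (expi (G y)) _ AVq.
have A12 := Cstar_add CA A1' A2'.
have Ab : A b := Cstar_add CA A12 A3'.
have Ab' : A (fun x => (be x)%:C%:M) by rewrite -bE.
have Abi : A (fun x => (be x)^-1%:C%:M) := rotation_scalar_inverse q0 cbe be0 Ab'.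
have bi : mfmul b (fun x => (be x)^-1%:C%:M) = one q.
  apply/funext => x; rewrite bE /mfmul -scalar_mxM -rmorphM mulfV ?gt_eqF//.
have : phi b y = 0.
  have e1 := phi_nsq _ _ Aa (phia y).
  have q2 := etrans (congr1 (fun f : matfun R q' => f y) phiUq) (uq y).
  have q3 := etrans (congr1 (fun f : matfun R q' => f y) phiVq) (vq y).
  have e2 := phi_nsq _ _ AUq q2.
  have e3 := phi_nsq _ _ AVq q3.
  exact: (phi_sum3 _ _ _ A1' A2' A3' e1 e2 e3).
have := congr1 (fun c : matfun R q => phi c y) bi; rewrite phiM// iso_one /mfmul => + e.
rewrite e mul0mx => /matrixP/(_ (Ordinal q0') (Ordinal q0')).
by rewrite !mxE eqxx => /esym/eqP; rewrite oner_eq0.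
Qed.

End Isomorphism.

(** * The classification *)

(** Winding numbers compose like matrices: H(F, G) - h is continuous and integer-valued, hence
    constant, and comparing its values at the origin and at the two unit translates gives the
    equations. *)
Lemma winding_compose (R : realType) (F G H h : R * R -> R) (a b c d m n k l : int) :
  continuous F -> continuous G -> continuous H -> continuous h ->
  (forall x1 x2, F (x1 + 1, x2) = F (x1, x2) + a%:~R /\
                 F (x1, x2 + 1) = F (x1, x2) + b%:~R) ->
  (forall x1 x2, G (x1 + 1, x2) = G (x1, x2) + c%:~R /\
                 G (x1, x2 + 1) = G (x1, x2) + d%:~R) ->
  (forall x1 x2, H (x1 + 1, x2) = H (x1, x2) + m%:~R /\
                 H (x1, x2 + 1) = H (x1, x2) + n%:~R) ->
  (forall x1 x2, h (x1 + 1, x2) = h (x1, x2) + k%:~R /\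
                 h (x1, x2 + 1) = h (x1, x2) + l%:~R) ->
  (forall y, expi (H (F y, G y)) = expi (h y)) ->
  a * m + c * n = k /\ b * m + d * n = l.
Proof.
move=> cF cG cH ch Fw Gw Hw hw e.
pose D y := H (F y, G y) - h y.
have cD : continuous D.
  apply: continuous_addf; last exact: continuous_oppf.
  by apply: continuous_compf cH; exact: continuous_pairf.
have DZ y : exists i : int, D y = i%:~R.
  have [i iE] := expi_inj (e y); exists i.
  by rewrite /D iE addrAC subrr add0r.
have Dc y : D y = D (0, 0) by apply: int_valued_const => // t _; exact: DZ.
have Dk y z (i j : int) : H (F y, G y) = H (F z, G z) + i%:~R ->
    h y = h z + j%:~R -> i = j.
  move=> Hi hj; have := etrans (Dc y) (esym (Dc z)); rewrite /D Hi hj => E.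
  by apply: (@intr_inj R); lra.
split.
  apply: (Dk (0 + 1, 0) (0, 0)); last by rewrite (hw 0 0).1.
  by rewrite (Fw 0 0).1 (Gw 0 0).1 (winding_int Hw).
apply: (Dk (0, 0 + 1) (0, 0)); last by rewrite (hw 0 0).2.
by rewrite (Fw 0 0).2 (Gw 0 0).2 (winding_int Hw).
Qed.

Lemma mod_inverse_exists p q : (0 < p)%N -> coprime p q ->
  exists r : nat, (q %| p%:Z * r%:Z - 1)%Z.
Proof.
move=> p0 /eqP pq; case: (egcdnP q p0) => r k e _; exists r.
by rewrite -PoszM mulnC e pq PoszD addrK PoszM dvdz_mull.
Qed.

Lemma int_mul_eq1 (x y : int) : x * y = 1 -> x = 1 \/ x = -1.
Proof.
move=> /(congr1 absz); rewrite abszM => /eqP; rewrite muln_eq1 => /andP[/eqP x1 _].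
by move: x1; case: x => x /= => [->|]; [left|case: x => //; right].
Qed.

Section Necessity.
Variables (R : realType) (p q : nat).
Hypotheses (q0 : (0 < q)%N) (pq : coprime p q).

(** The q-th powers commute with both matrices because w^q = 1, and the commutant of the pair is
    scalar. *)
Lemma twisted_power_scalar (u v : 'M[Cplx R]_q) :
  u \in unitmx -> v \in unitmx -> u *m v = zeta R q p *: (v *m u) ->
  (exists c, u ^+ q = c%:M) /\ (exists c, v ^+ q = c%:M).
Proof.
move=> uu uv uv0.
have w1 : zeta R q p ^+ q = 1 by exact: wq1.
have comm := twisted_commutant (expi_prim_root R q0 pq) uu uv uv0.
split; apply: comm.
- exact: (commrX q (commr_refl u)).
- by have := exp_twist q uv0; rewrite w1 scale1r => e; exact/esym.
- by have := exp_twistr q uv0; rewrite w1 scale1r.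
- exact: (commrX q (commr_refl v)).
Qed.

End Necessity.

Lemma isomorphic_dvd (R : realType) (p q p' q' : nat) :
  (0 < q)%N -> (0 < q')%N -> coprime p q -> coprime p' q' ->
  Cstar_isomorphic (rotation_alg R p q) (rotation_alg R p' q') -> q = q'.
Proof.
move=> q0 q0' pq pq' [phi [[phi_fun phi_inj phi_surj] phiD phiZ phiM phiS]].
have surj b : rotation_alg R p' q' b -> exists2 a, rotation_alg R p q a & phi a = b.
  by move=> /phi_surj.
have inj a b : rotation_alg R p q a -> rotation_alg R p q b -> phi a = phi b -> a = b.
  by move=> Aa Ab; apply: phi_inj; exact: mem_set.
apply/eqP; rewrite eqn_dvd; apply/andP; split.
  exact: (iso_dvd q0 q0' pq surj phiZ phiM phiS).
exact: (iso_dvd' q0 q0' pq' inj surj phiZ phiM phiS).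
Qed.

Lemma isomorphic_parameter (R : realType) (p q p' : nat) :
  (1 <= p <= q - 1)%N -> coprime p q -> (1 <= p' <= q - 1)%N -> coprime p' q ->
  Cstar_isomorphic (rotation_alg R p q) (rotation_alg R p' q) ->
  p' = p \/ p' = (q - p)%N.
Proof.
move=> /andP[p0 pq1] pq /andP[p0' pq1'] pq'.
have q0 : (0 < q)%N by lia.
move=> [phi [[phi_fun phi_inj phi_surj] phiD phiZ phiM phiS]].
have surj b : rotation_alg R p' q b -> exists2 a, rotation_alg R p q a & phi a = b.
  by move=> /phi_surj.
have inj a b : rotation_alg R p q a -> rotation_alg R p q b -> phi a = phi b -> a = b.
  by move=> Aa Ab; apply: phi_inj; exact: mem_set.
have [r pr] := mod_inverse_exists p0 pq.
have [r' pr'] := mod_inverse_exists p0' pq'.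
have AU := @rotation_U R p q; have AV := @rotation_V R p q.
pose u := phi (@Ufun R q); pose v := phi (@Vfun R p q).
have uv := iso_twist q0 phiZ phiM : forall x, u x *m v x = zeta R q p *: (v x *m u x).
have uu := iso_u_unit q0 q0 surj phiM phiS : forall x, u x \in unitmx.
have vu := iso_v_unit q0 q0 surj phiM phiS : forall x, v x \in unitmx.
have Uq1 := unitary_power q (@Ufun_unitary R q q0).
have Vq1 := unitary_power q (@Vfun_unitary R p q).
have AUq := rotation_exp q0 q AU; have phiUq := iso_exp q0 q0 surj phiM q AU.
have AVq := rotation_exp q0 q AV; have phiVq := iso_exp q0 q0 surj phiM q AV.
have A'Uq := phi_fun _ AUq; have A'Vq := phi_fun _ AVq.
have Uq1' := iso_unitary q0 q0 surj phiM phiS AUq Uq1.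
have Vq1' := iso_unitary q0 q0 surj phiM phiS AVq Vq1.
rewrite phiUq in A'Uq Uq1'; rewrite phiVq in A'Vq Vq1'.
have [F [a [b [cF uF Fw]]]] := central_unitary_lift q0 pr' A'Uq Uq1'
  (fun x => (twisted_power_scalar q0 pq (uu x) (vu x) (uv x)).1).
have [G [c [d [cG vG Gw]]]] := central_unitary_lift q0 pr' A'Vq Vq1'
  (fun x => (twisted_power_scalar q0 pq (uu x) (vu x) (uv x)).2).
have := winding_congruence q0 pq pr pr' (rotation_quasi_periodic q0 pr' (phi_fun _ AU))
  (rotation_quasi_periodic q0 pr' (phi_fun _ AV)) uv uF vG cF cG Fw Gw.
(* Bijectivity pulls a scalar unitary of the target back to a central unitary of the source, which
   [twisted_commutant] makes scalar at every point and hence liftable. *)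
have central (h : R * R -> R) (z : matfun R q) : rotation_alg R p' q z ->
    mfmul z (mfstar z) = (fun=> 1%:M) -> (forall x, z x = (expi (h x))%:M) ->
    exists H : R * R -> R, exists m n : int, [/\ continuous H,
      forall x1 x2, H (x1 + 1, x2) = H (x1, x2) + m%:~R /\
                    H (x1, x2 + 1) = H (x1, x2) + n%:~R &
      forall y, expi (H (F y, G y)) = expi (h y)].
  move=> A'z z1 zE; have [w Aw wz] := surj z A'z.
  have w1 : mfmul w (mfstar w) = (fun=> 1%:M).
    by apply: (iso_unitary_inv q0 q0 inj surj phiM phiS Aw); rewrite wz.
  have zc (e : matfun R q) : mfmul (phi e) z = mfmul z (phi e).
    by apply/funext => x; rewrite /mfmul zE scalar_mxC.
  have wc (e : matfun R q) x : rotation_alg R p q e -> e x *m w x = w x *m e x.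
    move=> Ae.
    have Aew := Cstar_mul (@rotation_Cstar R p q q0) Ae Aw.
    have Awe := Cstar_mul (@rotation_Cstar R p q q0) Aw Ae.
    have E : mfmul e w = mfmul w e.
      by apply: inj => //; rewrite !phiM// wz zc.
    exact: (congr1 (fun b : matfun R q => b x) E).
  have ws x : exists k, w x = k%:M.
    have uU : @Ufun R q x \in unitmx := unitary_unit x (@Ufun_unitary R q q0).
    have uV : @Vfun R p q x \in unitmx := unitary_unit x (@Vfun_unitary R p q).
    have [k kE] := twisted_commutant (expi_prim_root R q0 pq) uU uV
      (@UV_twist R p q q0 x) (wc _ x AU) (wc _ x AV).
    by exists k.
  have [H [m [n [cH wH Hw]]]] := central_unitary_lift q0 pr Aw w1 ws.
  exists H, m, n; split => //.
  have wh y : phi w y = (expi (h y))%:M by rewrite wz.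
  exact: (iso_evaluation q0 q0 surj phiD phiZ phiM uF vG Aw cH wH Hw wh).
(* The q-th powers of the target's generators are exp(2 pi i x1) and exp(2 pi i x2), with windings
   (1, 0) and (0, 1). *)
have [H1 [m1 [n1 [cH1 H1w H1e]]]] := central fst _
  (rotation_exp q0 q (@rotation_U R p' q)) Uq1 (Ufun_exp q0).
have [H2 [m2 [n2 [cH2 H2w H2e]]]] := central snd _
  (rotation_exp q0 q (@rotation_V R p' q)) (unitary_power q (@Vfun_unitary R p' q))
  (Vfun_exp p' q0).
have [e1 e2] := winding_compose (k := 1) (l := 0) cF cG cH1 (@continuous_fst R R)
  Fw Gw H1w (fun x1 x2 => conj erefl (esym (addr0 _))) H1e.
have [e3 e4] := winding_compose (k := 0) (l := 1) cF cG cH2 (@continuous_snd R R)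
  Fw Gw H2w (fun x1 x2 => conj (esym (addr0 _)) erefl) H2e.
(* The four equations exhibit an integer inverse of the winding matrix, so its determinant is a
   unit. *)
have det1 : (a * d - b * c) * (m1 * n2 - n1 * m2) = 1.
  have -> : (a * d - b * c) * (m1 * n2 - n1 * m2) =
    (a * m1 + c * n1) * (b * m2 + d * n2) - (b * m1 + d * n1) * (a * m2 + c * n2) by ring.
  by rewrite e1 e2 e3 e4.
move=> /dvdzP[k kE]; move: pr pr' => /dvdzP[s sE] /dvdzP[s' sE'].
(* Multiplying r j = r' by p p' modulo q removes the inverses and leaves p' j = p; the witness
   collects the multiples of [q] dropped on the way. *)
have fin (j : int) : r%:Z * j - r'%:Z = k * q -> (q%:Z %| p'%:Z * j - p%:Z)%Z.
  move=> E; apply/dvdzP.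
  exists (p%:Z * p'%:Z * k - p'%:Z * j * s + p%:Z * s').
  have h1 : p%:Z * r%:Z = s * q + 1 by rewrite -sE subrK.
  have h2 : p'%:Z * r'%:Z = s' * q + 1 by rewrite -sE' subrK.
  rewrite mulrDl mulrBl -[_ * k * _]mulrA -E.
  have -> : p%:Z * p'%:Z * (r%:Z * j - r'%:Z) =
    (p%:Z * r%:Z) * p'%:Z * j - (p'%:Z * r'%:Z) * p%:Z by ring.
  by rewrite h1 h2; ring.
have := fin _ kE.
(* For j = 1, |p' - p| < q forces p' = p; for j = -1, 0 < p + p' < 2 q forces p + p' = q. *)
case: (int_mul_eq1 det1) => ->; rewrite ?mulr1 ?mulrN1 => /dvdzP[t tE].
  left; have t0 : t = 0 by nia.
  by rewrite t0 mul0r in tE; lia.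
right; have t1 : t = -1 by nia.
by rewrite t1 mulN1r in tE; lia.
Qed.

(** * The reflection isomorphism *)

Section Reflection.
Variables (R : realType) (q : nat).
Hypothesis q0 : (0 < q)%N.

Definition reflect (a : matfun R q) : matfun R q := fun x => a (x.1, - x.2).

Lemma reflectK a : reflect (reflect a) = a.
Proof. by apply/funext => -[x1 x2]; rewrite /reflect opprK. Qed.

Lemma periodic_reflect a : periodic_alg R q a -> periodic_alg R q (reflect a).
Proof.
move=> [ca pa]; split.
  apply: continuous_compf ca; apply: continuous_pairf; first exact: continuous_fst.
  by apply: continuous_oppf; exact: continuous_snd.
move=> x1 x2; rewrite /reflect /=; split; first by rewrite (pa _ _).1.
by rewrite opprD -(pa x1 (- x2 - q%:R)).2 subrK.
Qed.

(** Reflection inverts the factor exp(2 pi i x2 / q) but not V0. The adjoint inverts both, and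
    replacing p by q - p inverts V0 once more since q - p = - p modulo q. *)
Lemma Vfun_reflect p : (p <= q)%N ->
  mfstar (@Vfun R (q - p) q) = reflect (@Vfun R p q).
Proof.
move=> pq; apply/funext => x.
rewrite /mfstar -/(mxstar _) /reflect !VfunE mxstarZ expi_conj /= mulNr.
congr (_ *: _); rewrite !V0E /mxstar map_diag_mx tr_diag_mx; congr diag_mx.
apply/rowP => j; rewrite !mxE rmorphXn /=; congr (_ ^+ _).
have -> : Num.conj (zeta R q (q - p)%N) = zeta R q (- (q - p)%N%:Z).
  by rewrite /zeta expi_conj intrN mulNr.
apply/zeta_eq => //; apply/dvdzP; exists (-1).
by rewrite -subzn//; ring.
Qed.

Lemma reflect_rotation p : (p <= q)%N ->
  rotation_alg R p q `<=` [set a | rotation_alg R (q - p) q (reflect a)].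
Proof.
(* By minimality it suffices that [S] is a closed subalgebra containing the generators; periodicity
   is built into [S] because [Cstar_sub] demands it. *)
move=> pq; pose S : set (matfun R q) :=
  [set a | periodic_alg R q a /\ rotation_alg R (q - p) q (reflect a)].
have CA := @rotation_Cstar R (q - p) q q0.
suff sub : rotation_alg R p q `<=` S by move=> a /sub[].
have Sp : S `<=` periodic_alg R q by move=> a [].
apply: rotation_minimal.
- split => //.
  + by split; [exact: periodic_zero|exact: (Cstar_zero CA)].
  + by move=> a b [pa Aa] [pb Ab]; split; [exact: periodic_add|exact: (Cstar_add CA Aa Ab)].
  + by move=> c a [pa Aa]; split; [exact: periodic_scale|exact: (Cstar_scale CA c Aa)].
  + by move=> a b [pa Aa] [pb Ab]; split; [exact: periodic_mul|exact: (Cstar_mul CA Aa Ab)].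
  + by move=> a [pa Aa]; split; [exact: periodic_star|exact: (Cstar_star CA Aa)].
  + move=> a pa ha; split => //.
    apply: (Cstar_uniform_closed CA (periodic_reflect pa)) => e e0.
    have [b [_ Ab] hb] := periodic_approx Sp pa ha e0.
    by exists (reflect b) => // x i j; exact: hb.
- split; first exact: Ufun_periodic.
  rewrite (_ : reflect _ = @Ufun R q); first exact: rotation_U.
  by apply/funext => x; rewrite /reflect !UfunE.
- split; first exact: Vfun_periodic.
  by rewrite -Vfun_reflect//; apply: (Cstar_star CA); exact: rotation_V.
Qed.

(** Surjectivity is [reflect_rotation] for q - p, because [reflect] is an involution and q - (q - p)
    = p. *)
Lemma reflect_isomorphic p : (p <= q)%N ->
  Cstar_isomorphic (rotation_alg R p q) (rotation_alg R (q - p) q).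
Proof.
move=> pq; exists reflect; split => //; split.
- exact: reflect_rotation.
- by move=> a b _ _ /(congr1 reflect); rewrite !reflectK.
- move=> b Ab; exists (reflect b); last exact: reflectK.
  by have := reflect_rotation (leq_subr p q) Ab; rewrite /= subKn.
Qed.

End Reflection.

Theorem theorem4 (R : realType) (p q p' q' : nat) :
  (1 <= p <= q - 1)%N -> coprime p q ->
  (1 <= p' <= q' - 1)%N -> coprime p' q' ->
  Cstar_isomorphic (rotation_alg R p q) (rotation_alg R p' q') <->
  q' = q /\ (p' = p \/ p' = (q - p)%N).
Proof.
move=> pq1 pq pq1' pq'; split=> [iso|[-> [->|->]]].
- have qq' : q = q' by apply: isomorphic_dvd pq pq' iso; lia.
  move: pq1' pq' iso; rewrite -qq' => pq1' pq' iso; split => //.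
  exact: isomorphic_parameter pq1 pq pq1' pq' iso.
- exists id; split => //; split; [by move=> a|by move=> a b _ _|].
  by move=> a Aa; exists a.
- by apply: reflect_isomorphic; lia.
Qed.
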